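(* Let $\rho>0$ and put $\delta_{n,\rho}=\frac{\rho+1}{n\rho+1}$. There is a constant $C_{\rho}>0$, independent of $n$, $f$, $g$ and $x$, such that for all real-valued $f,g\in C^{1}[0,1]$, all $n\ge1$ and all $x\in[0,1]$, $$n\left|U_{n}^{\rho}(fg)(x)-U_{n}^{\rho}(f)(x)U_{n}^{\rho}(g)(x)-\frac{\rho+1}{\rho n}x(1-x)f'(x)g'(x)\right|\le C_{\rho}\frac{\rho+1}{\rho}x(1-x)\Big\{\omega_{3}(f';\delta_{n,\rho}^{1/6})\,\omega_{3}(g';\delta_{n,\rho}^{1/6})$$ $$+\|f'\|\,\omega_{3}(g';\delta_{n,\rho}^{1/6})+\|g'\|\,\omega_{3}(f';\delta_{n,\rho}^{1/6})+\max\{\delta_{n,\rho}^{1/2}\|f\|,\omega_{3}(f';\delta_{n,\rho}^{1/6})\}\cdot\max\{\delta_{n,\rho}^{1/2}\|g\|,\omega_{3}(g';\delta_{n,\rho}^{1/6})\}\Big\}.$$ Moreover, the constants $C_{\rho}$ remain bounded as $\rho\to\infty$.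
   Context: For $\rho>0$, $n\in\mathbb{N}$, $f\in C[0,1]$, $x\in[0,1]$, the Păltănea operators are $$U_{n}^{\rho}(f)(x)=\sum_{k=1}^{n-1}\Big(\int_{0}^{1}f(t)\mu_{n,k}^{\rho}(t)\,dt\Big)p_{n,k}(x)+f(0)(1-x)^{n}+f(1)x^{n},$$ where $p_{n,k}(x)=\binom{n}{k}x^{k}(1-x)^{n-k}$, $\mu_{n,k}^{\rho}(t)=\frac{t^{k\rho-1}(1-t)^{(n-k)\rho-1}}{B(k\rho,(n-k)\rho)}$ for $1\le k\le n-1$, and $B(a,b)=\int_{0}^{1}t^{a-1}(1-t)^{b-1}dt$ is Euler's Beta function. $\|\cdot\|$ denotes the uniform norm on $C[0,1]$. For $h\in C[0,1]$ and $\delta>0$, $\omega_{3}(h;\delta)=\sup\{|h(x+3t)-3h(x+2t)+3h(x+t)-h(x)| : 0<t\le\delta,\ x,x+3t\in[0,1]\}$. *)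

(* Defs.v *)
From Stdlib Require Import Reals.
From Coquelicot Require Import Coquelicot.
Open Scope R_scope.

Definition pnk (n k : nat) (x : R) : R :=
  Binomial.C n k * x ^ k * (1 - x) ^ (n - k).

(* Euler's Beta function B(a,b) = int_0^1 t^(a-1) (1-t)^(b-1) dt, as an
   improper Riemann integral (the integrand may be unbounded at 0 and 1). *)
Definition Beta (a b : R) : R :=
  RInt_gen (fun t => Rpower t (a - 1) * Rpower (1 - t) (b - 1))
           (at_right 0) (at_left 1).

Definition mu (rho : R) (n k : nat) (t : R) : R :=
  Rpower t (INR k * rho - 1) * Rpower (1 - t) (INR (n - k) * rho - 1)
  / Beta (INR k * rho) (INR (n - k) * rho).

(* Paltanea operators U_n^rho(f)(x). The sum over k = 1..n-1 is
   Coquelicot's sum_n_m (empty, i.e. 0, when n - 1 < 1). *)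
Definition U (rho : R) (n : nat) (f : R -> R) (x : R) : R :=
  sum_n_m (fun k => RInt_gen (fun t => f t * mu rho n k t)
                              (at_right 0) (at_left 1) * pnk n k x)
          1 (n - 1)
  + f 0 * (1 - x) ^ n + f 1 * x ^ n.

Definition supnorm (f : R -> R) : R :=
  real (Lub_Rbar (fun y => exists x, 0 <= x <= 1 /\ y = Rabs (f x))).

Definition omega3 (h : R -> R) (delta : R) : R :=
  real (Lub_Rbar (fun y => exists x t, 0 < t <= delta /\ 0 <= x /\ x + 3 * t <= 1 /\
     y = Rabs (h (x + 3 * t) - 3 * h (x + 2 * t) + 3 * h (x + t) - h x))).

Definition C1_01 (f df : R -> R) : Prop :=
  (forall x, 0 <= x <= 1 ->
     filterlim (fun y => (f y - f x) / (y - x))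
               (within (fun y => 0 <= y <= 1 /\ y <> x) (locally x))
               (locally (df x))) /\
  (forall x, 0 <= x <= 1 ->
     filterlim df (within (fun y => 0 <= y <= 1) (locally x)) (locally (df x))).

(* Main.v *)
(* For fixed x, E = U_n^rho(.)(x) is a positive linear functional with E 1 = 1,
   E(t-x) = 0, E(t-x)^2 = x(1-x) d, and with third and fourth central moments
   O(x(1-x) d^2), where d = (rho+1)/(n rho+1) <= 1.  Write h = d^(1/6) and
   w = omega_3(f';h).  Three iterated means of f' over translates give phi with
   |f' - phi| <= C w and |phi'''| <= C w/h^3, first on [0,3/4] only (the
   translates go to the right); the rest of [0,1] is far from x when x <= 1/2 and
   is controlled by ||f||, and x >= 1/2 follows by reflection.  Hence, with
   M = ||f|| + w/h^3 and s = t - x,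
     f(t) = f(x) + f'(x) s + a s^2 + O(w |s| + M |s|^3),   f'(x), a = O(M).
   Inserting this and its analogue for g (w', M') in
   E((f-f(x))(g-g(x))) - E(f-f(x)) E(g-g(x)), every term but f'(x) g'(x) E s^2 is
   O(x(1-x) d) times w w' + ||f'|| w' + ||g'|| w + d M M', and
   d^(1/2) M = d^(1/2) ||f|| + w.  The constant obtained is even independent of rho. *)
Require Import Defs.
From Stdlib Require Import Reals Lra Lia FunctionalExtensionality.
From Coquelicot Require Import Coquelicot.
Open Scope R_scope.

(** * Smoothing at the scale of third differences *)

(** The obstacle is that third differences annihilate quadratics: for a cubic f the modulus w is 0,
    so w alone controls neither f'(x) nor the second Taylor coefficient. They are recovered from f
    itself: on an interval of fixed length to the right of x, f - f(x) is close to a cubic in s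
    without constant term, and three values determine its coefficients. This is how ||f|| enters M.
    The exponent 1/6 makes h^3 = d^(1/2) =: q, so that q M = q ||f|| + w, and in particular w <= q
    M. This inequality lets a mixed term w |s|^3 be shared between s^2 and s^4. Two cancellations
    are indispensable. E s = 0 removes f'(x) s from the means E(f - f(x)) and E(g - g(x)), and the
    signed third moment is O(x(1-x) d^2), whereas Cauchy-Schwarz gives only d^(3/2) for E|s|^3. In
    the product of the means the factor x(1-x) comes from (E|s|)^2 <= E s^2. *)

Lemma mvt_bound (g dg : R -> R) (a b m : R) :
  (forall t, Rmin a b <= t <= Rmax a b -> is_derive g t (dg t)) ->
  (forall t, Rmin a b <= t <= Rmax a b -> Rabs (dg t) <= m) ->
  Rabs (g b - g a) <= m * Rabs (b - a).
Proof.
  intros Hd Hm.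
  destruct (MVT_gen g a b dg) as [c [Hc ->]].
  - intros t Ht; apply Hd; lra.
  - intros t Ht; apply continuity_pt_filterlim.
    apply (ex_derive_continuous g t); exists (dg t); now apply Hd.
  - rewrite Rabs_mult. apply Rmult_le_compat_r; [apply Rabs_pos | now apply Hm].
Qed.

(** One integration step of a Taylor estimate: on the segment from [x] to [t] the bound on [dg] is
    largest at [t], so the mean value theorem raises each power of |t - x| by one. The separate [al]
    carries the error of size w along with the power term. *)
Lemma mvt_power (g dg : R -> R) (lo hi x al m : R) (k : nat) :
  (forall t, lo <= t <= hi -> is_derive g t (dg t)) ->
  0 <= m -> lo <= x <= hi ->
  (forall t, lo <= t <= hi -> Rabs (dg t) <= al + m * Rabs (t - x) ^ k) ->
  forall t, lo <= t <= hi ->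
    Rabs (g t - g x) <= al * Rabs (t - x) + m * Rabs (t - x) ^ S k.
Proof.
  intros Hd Hm Hx Hb t Ht.
  replace (al * Rabs (t - x) + m * Rabs (t - x) ^ S k)
    with ((al + m * Rabs (t - x) ^ k) * Rabs (t - x)) by (simpl; ring).
  assert (Hin : forall s, Rmin x t <= s <= Rmax x t -> lo <= s <= hi).
  { intros s; unfold Rmin, Rmax; destruct (Rle_dec x t); lra. }
  apply mvt_bound with dg.
  - intros s Hs; apply Hd, Hin, Hs.
  - intros s Hs. apply Rle_trans with (1 := Hb s (Hin s Hs)).
    apply Rplus_le_compat_l, Rmult_le_compat_l; [assumption|].
    apply pow_incr; split; [apply Rabs_pos|].
    revert Hs; unfold Rmin, Rmax, Rabs.
    destruct (Rle_dec x t), (Rcase_abs (s - x)), (Rcase_abs (t - x)); lra.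
Qed.

(* [smooth h] applied to a primitive of [F] is the mean over [0 < tau < h] of
   [3 F(t+tau) - 3 F(t+2 tau) + F(t+3 tau)], which differs from [F t] by a mean
   of third differences; iterating it three times gains three derivatives. *)
Definition smooth (h : R) (G : R -> R) (t : R) : R :=
  (3 * (G (t + h) - G t) - 3 / 2 * (G (t + 2 * h) - G t)
   + 1 / 3 * (G (t + 3 * h) - G t)) / h.

Definition diff (h : R) (G : R -> R) (t : R) : R := G (t + h) - G t.

(** With T the shift by [h], [smooth] is (3(T - 1) - 3/2 (T^2 - 1) + 1/3 (T^3 - 1))/h; dividing the
    numerator by T - 1 leaves 11/6 - 7/6 T + 1/3 T^2. *)
Definition cosmooth (h : R) (G : R -> R) (t : R) : R :=
  11 / 6 * G t - 7 / 6 * G (t + h) + 1 / 3 * G (t + 2 * h).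

Lemma smooth_factor (h : R) (G : R -> R) :
  smooth h G = fun t => / h * cosmooth h (diff h G) t.
Proof.
  apply functional_extensionality; intros t.
  unfold smooth, cosmooth, diff.
  replace (t + 2 * h + h) with (t + 3 * h) by ring.
  replace (t + h + h) with (t + 2 * h) by ring.
  unfold Rdiv at 1; generalize (/ h); intros k; field.
Qed.

Lemma diff_cosmooth (h c : R) (G : R -> R) :
  diff h (fun t => c * cosmooth h G t) = fun t => c * cosmooth h (diff h G) t.
Proof.
  apply functional_extensionality; intros t.
  unfold cosmooth, diff.
  replace (t + 2 * h + h) with (t + h + 2 * h) by ring. field.
Qed.

Lemma cosmooth_scal (h c : R) (G : R -> R) :
  cosmooth h (fun t => c * G t) = fun t => c * cosmooth h G t.
Proof. apply functional_extensionality; intros t; unfold cosmooth; field. Qed.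

(** Polynomials in the shift commute, so the three factors T - 1 can be collected innermost. On f'
    they form a third difference, at most w, and each [cosmooth] costs a constant free of [h]; only
    the factors 1/h remain. *)
Lemma smooth_smooth_smooth (h : R) (G : R -> R) :
  smooth h (smooth h (smooth h G)) =
  fun t => / h * (/ h * (/ h *
    cosmooth h (cosmooth h (cosmooth h (diff h (diff h (diff h G))))) t)).
Proof.
  rewrite !smooth_factor, !diff_cosmooth, !cosmooth_scal.
  reflexivity.
Qed.

(** The constant is 11/6 + 7/6 + 1/3. *)
Lemma cosmooth_bound (h hi m : R) (G : R -> R) :
  0 < h -> (forall t, 0 <= t <= hi -> Rabs (G t) <= m) ->
  forall t, 0 <= t <= hi - 2 * h -> Rabs (cosmooth h G t) <= 10 / 3 * m.
Proof.
  intros Hh HG t Ht; unfold cosmooth.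
  assert (H0 := HG t ltac:(lra)). assert (H1 := HG (t + h) ltac:(lra)).
  assert (H2 := HG (t + 2 * h) ltac:(lra)).
  apply Rabs_le_between in H0, H1, H2. apply Rabs_le_between; lra.
Qed.

Lemma smooth_minus (h : R) (G1 G2 : R -> R) :
  smooth h (fun s : R => G1 s - G2 s) = fun t => smooth h G1 t - smooth h G2 t.
Proof. apply functional_extensionality; intros t; unfold smooth, Rdiv; generalize (/ h); intros k; field. Qed.

Lemma is_derive_smooth (h : R) (G dG : R -> R) :
  (forall t, is_derive G t (dG t)) ->
  forall t, is_derive (smooth h G) t (smooth h dG t).
Proof.
  intros HG t; unfold smooth.
  auto_derive.
  - repeat split; eexists; apply HG.
  - rewrite !(fun u => is_derive_unique (fun x : R => G x) u _ (HG u)).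
    unfold Rdiv; ring.
Qed.

(** The increments of [G] over h, 2h, 3h are at most [m] times these lengths, and 3 + 3/2 * 2 + 1/3
    * 3 = 7. *)
Lemma smooth_bound (h hi m : R) (G dG : R -> R) :
  0 < h -> (forall t, is_derive G t (dG t)) ->
  (forall t, 0 <= t <= hi -> Rabs (dG t) <= m) ->
  forall t, 0 <= t <= hi - 3 * h -> Rabs (smooth h G t) <= 7 * m.
Proof.
  intros Hh Hd Hm t Ht.
  assert (H : forall c, 0 <= c <= 3 -> Rabs (G (t + c * h) - G t) <= m * (c * h)).
  { intros c Hc.
    assert (H0 : 0 <= c * h) by nra. assert (H3 : c * h <= 3 * h) by nra.
    replace (m * (c * h)) with (m * Rabs (t + c * h - t)).
    2:{ f_equal. rewrite Rabs_pos_eq; lra. }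
    apply mvt_bound with dG.
    - intros s _; apply Hd.
    - intros s; rewrite Rmin_left, Rmax_right by lra; intros Hs; apply Hm; lra. }
  assert (H1 := H 1 ltac:(lra)). assert (H2 := H 2 ltac:(lra)).
  assert (H3 := H 3 ltac:(lra)). rewrite Rmult_1_l in H1.
  unfold smooth. unfold Rdiv at 1. rewrite Rabs_mult, (Rabs_pos_eq (/ h)).
  2:{ left; now apply Rinv_0_lt_compat. }
  apply Rmult_le_reg_r with h; [assumption|].
  rewrite Rmult_assoc, Rinv_l, Rmult_1_r by lra.
  apply Rabs_le_between in H1, H2, H3. apply Rabs_le_between; lra.
Qed.

Lemma smooth_primitive_close (h w : R) (f F : R -> R) :
  0 < h -> (forall t, is_derive f t (F t)) ->
  (forall t s, 0 < s <= h -> 0 <= t -> t + 3 * s <= 1 ->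
     Rabs (F (t + 3 * s) - 3 * F (t + 2 * s) + 3 * F (t + s) - F t) <= w) ->
  forall t, 0 <= t <= 1 - 3 * h -> Rabs (F t - smooth h f t) <= w.
Proof.
  intros Hh Hd Hw t Ht.
  (* The derivative of [psi] at s is exactly the third difference of [F] at [t] with step s, and
     [psi h - psi 0] is h times [smooth h f t - F t]. *)
  pose (psi s := 3 * (f (t + s) - f t) - 3 / 2 * (f (t + 2 * s) - f t)
                 + 1 / 3 * (f (t + 3 * s) - f t) - s * F t).
  pose (dpsi s := 3 * F (t + s) - 3 * F (t + 2 * s) + F (t + 3 * s) - F t).
  assert (Hpsi : forall s, is_derive psi s (dpsi s)).
  { intros s; unfold psi, dpsi.
    auto_derive.
    - repeat split; eexists; apply Hd.
    - rewrite !(fun u => is_derive_unique (fun x : R => f x) u _ (Hd u)).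
      field. }
  assert (Hb : Rabs (psi h - psi 0) <= w * Rabs (h - 0)).
  { apply mvt_bound with dpsi.
    - intros s _; apply Hpsi.
    - intros s; rewrite Rmin_left, Rmax_right by lra; intros Hs; unfold dpsi.
      (* [Hw] covers positive steps only. At s = 0 the difference vanishes, and 0 <= w is read off
         from step [h]. *)
      destruct (Req_dec s 0) as [-> | Hs0].
      + replace (_ - F t) with 0.
        * rewrite Rabs_R0. apply Rle_trans with (2 := Hw t h ltac:(lra) ltac:(lra) ltac:(lra)).
          apply Rabs_pos.
        * rewrite !Rmult_0_r, !Rplus_0_r; ring.
      + replace (_ - F t) with
          (F (t + 3 * s) - 3 * F (t + 2 * s) + 3 * F (t + s) - F t) by ring.
        apply Hw; lra. }
  rewrite Rminus_0_r, (Rabs_pos_eq h) in Hb by lra.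
  replace (F t - smooth h f t) with (- (psi h - psi 0) * / h).
  2:{ unfold psi, smooth. rewrite !Rmult_0_r, !Rplus_0_r. field. lra. }
  rewrite Rabs_mult, Rabs_Ropp, (Rabs_pos_eq (/ h)).
  2:{ left; now apply Rinv_0_lt_compat. }
  apply Rmult_le_reg_r with h; [assumption|].
  rewrite Rmult_assoc, Rinv_l, Rmult_1_r by lra. assumption.
Qed.

Lemma is_derive_primitive (f : R -> R) :
  (forall t, continuous f t) -> forall t, is_derive (fun u => RInt f 0 u) t (f t).
Proof.
  intros Hf t. apply (is_derive_RInt f (fun u => RInt f 0 u) 0).
  - apply filter_forall; intros u. apply (RInt_correct f 0 u).
    apply (ex_RInt_continuous f); intros z _; apply Hf.
  - apply Hf.
Qed.

(** Write S for [smooth h] and f2, f3 for iterated primitives of [f]. The approximant is SSS f3,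
    whose third derivative is SSS F. The error telescopes into (F - S f) + S(f - S f2) + SS(f2 - S
    f3), hence 57 = 1 + 7 + 49; and 38 exceeds (10/3)^3. Each S looks 3h to the right, so 9h <= 1/4
    leaves [0,3/4]. *)
Lemma smooth_approx (h w : R) (f F : R -> R) :
  0 < h -> 9 * h <= 1 / 4 ->
  (forall t, is_derive f t (F t)) ->
  (forall t s, 0 < s <= h -> 0 <= t -> t + 3 * s <= 1 ->
     Rabs (F (t + 3 * s) - 3 * F (t + 2 * s) + 3 * F (t + s) - F t) <= w) ->
  exists phi phi1 phi2 phi3 : R -> R,
    (forall t, is_derive phi t (phi1 t)) /\
    (forall t, is_derive phi1 t (phi2 t)) /\
    (forall t, is_derive phi2 t (phi3 t)) /\
    (forall t, 0 <= t <= 3 / 4 -> Rabs (F t - phi t) <= 57 * w) /\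
    (forall t, 0 <= t <= 3 / 4 -> Rabs (phi3 t) <= 38 * w * / h ^ 3).
Proof.
  intros Hh Hh9 Hd Hw.
  set (f2 := fun u => RInt f 0 u). set (f3 := fun u => RInt f2 0 u).
  assert (D2 : forall t, is_derive f2 t (f t)).
  { apply is_derive_primitive. intros t; apply (ex_derive_continuous f).
    exists (F t); apply Hd. }
  assert (D3 : forall t, is_derive f3 t (f2 t)).
  { apply is_derive_primitive. intros t; apply (ex_derive_continuous f2).
    exists (f t); apply D2. }
  assert (E1 := smooth_primitive_close h w f F Hh Hd Hw).
  assert (DE1 : forall t, is_derive (fun s : R => f s - smooth h f2 s) t (F t - smooth h f t)).
  { intros t; apply (is_derive_minus f (smooth h f2)); [apply Hd|].
    apply is_derive_smooth, D2. }
  assert (DE2 : forall t, is_derive (fun s : R => f2 s - smooth h f3 s) t (f t - smooth h f2 t)).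
  { intros t; apply (is_derive_minus f2 (smooth h f3)); [apply D2|].
    apply is_derive_smooth, D3. }
  assert (E2 := smooth_bound h (1 - 3 * h) w _ _ Hh DE1 E1).
  assert (E3 := smooth_bound h (1 - 3 * h - 3 * h) (7 * w) _ _ Hh
                  (is_derive_smooth h _ _ DE2) E2).
  exists (smooth h (smooth h (smooth h f3))), (smooth h (smooth h (smooth h f2))),
    (smooth h (smooth h (smooth h f))), (smooth h (smooth h (smooth h F))).
  split; [|split; [|split; [|split]]].
  - do 3 apply is_derive_smooth; apply D3.
  - do 3 apply is_derive_smooth; apply D2.
  - do 3 apply is_derive_smooth; apply Hd.
  - intros t Ht.
    assert (B1 := E1 t ltac:(lra)). assert (B2 := E2 t ltac:(lra)).
    assert (B3 := E3 t ltac:(lra)).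
    rewrite smooth_minus in B2.
    rewrite !smooth_minus in B3.
    apply Rabs_le_between in B1, B2, B3. apply Rabs_le_between; lra.
  - intros t Ht. rewrite smooth_smooth_smooth.
    assert (C0 : forall s, 0 <= s <= 1 - 3 * h ->
              Rabs (diff h (diff h (diff h F)) s) <= w).
    { intros s Hs. unfold diff.
      replace (s + h + h + h) with (s + 3 * h) by ring.
      replace (s + h + h) with (s + 2 * h) by ring.
      match goal with |- Rabs ?e <= _ =>
        replace e with (F (s + 3 * h) - 3 * F (s + 2 * h) + 3 * F (s + h) - F s) by ring end.
      apply Hw; lra. }
    assert (C1 := cosmooth_bound _ _ _ _ Hh C0).
    assert (C2 := cosmooth_bound _ _ _ _ Hh C1).
    assert (C3 := cosmooth_bound _ _ _ _ Hh C2 t ltac:(lra)).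
    rewrite !Rabs_mult, !(Rabs_pos_eq (/ h)) by (left; now apply Rinv_0_lt_compat).
    assert (Hw0 : 0 <= w) by (apply Rle_trans with (2 := C0 0 ltac:(lra)), Rabs_pos).
    replace (38 * w * / h ^ 3) with (/ h * (/ h * (/ h * (38 * w)))) by (field; lra).
    do 3 (apply Rmult_le_compat_l; [left; now apply Rinv_0_lt_compat|]).
    lra.
Qed.

(** Taylor expansion of the smooth approximant to order two gives one for f', and integrating it
    gives one for f. The term phi''(x)/2 s^2 of f' is put into the remainder as O(M s^2), which is
    why phi''(x) must be bounded by M as well. *)
Lemma taylor_approx_left (h w N : R) (f F : R -> R) (x : R) :
  0 < h <= 1 -> 0 <= x <= 1 / 2 ->
  (forall t, is_derive f t (F t)) ->
  (forall t, 0 <= t <= 1 -> Rabs (f t) <= N) ->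
  (forall t s, 0 < s <= h -> 0 <= t -> t + 3 * s <= 1 ->
     Rabs (F (t + 3 * s) - 3 * F (t + 2 * s) + 3 * F (t + s) - F t) <= w) ->
  let K := 100000000000 in let M := N + w * / h ^ 3 in
  Rabs (F x) <= K * M /\
  exists a, Rabs a <= K * M /\
    forall t, 0 <= t <= 1 ->
      Rabs (f t - f x - F x * (t - x) - a * (t - x) ^ 2)
      <= K * (w * Rabs (t - x) + M * Rabs (t - x) ^ 3).
Proof.
  intros Hh Hx Hd HN Hw K M.
  assert (HN0 : 0 <= N) by (apply Rle_trans with (2 := HN 0 ltac:(lra)), Rabs_pos).
  assert (Hw0 : 0 <= w).
  { apply Rle_trans with (2 := Hw 0 (h / 3) ltac:(lra) ltac:(lra) ltac:(lra)), Rabs_pos. }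
  set (v := w * / h ^ 3) in M.
  assert (Hh3 : 0 < h ^ 3) by (apply pow_lt; lra).
  assert (Hh3' : h ^ 3 <= 1).
  { rewrite <- (pow1 3). apply pow_incr; lra. }
  assert (Hv : w = v * h ^ 3) by (unfold v; field; lra).
  assert (Hv0 : 0 <= v).
  { apply Rmult_le_pos; [assumption | left; now apply Rinv_0_lt_compat]. }
  assert (Hwv : w <= v) by (rewrite Hv; nra).
  (* The step h/36 guarantees 9h/36 <= 1/4, and 1772928 = 38 * 36^3. *)
  set (c := 1772928 * v).
  destruct (smooth_approx (h / 36) w f F ltac:(lra) ltac:(lra) Hd)
    as [p [p1 [p2 [p3 [D0 [D1 [D2 [Hp H3]]]]]]]].
  { intros t s Hs; apply Hw; lra. }
  replace (38 * w * / (h / 36) ^ 3) with c in H3.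
  2:{ unfold c, v; field; lra. }
  assert (Hc0 : 0 <= c) by (unfold c; lra).
  assert (E2 : forall t, 0 <= t <= 3 / 4 -> Rabs (p2 t - p2 x) <= c * Rabs (t - x) ^ 1).
  { intros t Ht.
    apply Rle_trans with (1 := mvt_power p2 p3 0 (3 / 4) x 0 c 0
      (fun t _ => D2 t) Hc0 ltac:(lra)
      ltac:(intros s Hs; simpl; rewrite Rmult_1_r, Rplus_0_l; auto) t Ht).
    lra. }
  assert (E1 : forall t, 0 <= t <= 3 / 4 ->
            Rabs (p1 t - p1 x - p2 x * (t - x)) <= c * Rabs (t - x) ^ 2).
  { intros t Ht.
    replace (p1 t - p1 x - p2 x * (t - x))
      with ((p1 t - p2 x * (t - x)) - (p1 x - p2 x * (x - x))) by ring.
    apply Rle_trans with (0 * Rabs (t - x) + c * Rabs (t - x) ^ 2); [|lra].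
    apply (mvt_power (fun t => p1 t - p2 x * (t - x)) (fun t => p2 t - p2 x) 0 (3 / 4));
      try assumption; try lra.
    - intros s _. assert (A := D1 s). auto_derive; [now exists (p2 s)|].
      rewrite (is_derive_unique (fun x : R => p1 x) s _ A); ring.
    - intros s Hs; rewrite Rplus_0_l; auto. }
  assert (E0 : forall t, 0 <= t <= 3 / 4 ->
            Rabs (p t - p x - p1 x * (t - x) - p2 x / 2 * (t - x) ^ 2)
            <= c * Rabs (t - x) ^ 3).
  { intros t Ht.
    replace (p t - p x - p1 x * (t - x) - p2 x / 2 * (t - x) ^ 2)
      with ((p t - p1 x * (t - x) - p2 x / 2 * (t - x) ^ 2)
            - (p x - p1 x * (x - x) - p2 x / 2 * (x - x) ^ 2)) by ring.
    apply Rle_trans with (0 * Rabs (t - x) + c * Rabs (t - x) ^ 3); [|lra].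
    apply (mvt_power (fun t => p t - p1 x * (t - x) - p2 x / 2 * (t - x) ^ 2)
             (fun t => p1 t - p1 x - p2 x * (t - x)) 0 (3 / 4));
      try assumption; try lra.
    - intros s _. assert (A := D0 s). auto_derive; [now exists (p1 s)|].
      rewrite (is_derive_unique (fun x : R => p x) s _ A); field.
    - intros s Hs; rewrite Rplus_0_l; auto. }
  assert (EF : forall t, 0 <= t <= 3 / 4 ->
            Rabs (F t - p x - p1 x * (t - x) - p2 x / 2 * (t - x) ^ 2)
            <= 57 * w + c * Rabs (t - x) ^ 3).
  { intros t Ht. assert (A1 := Hp t Ht). assert (A2 := E0 t Ht).
    apply Rabs_le_between in A1, A2. apply Rabs_le_between; lra. }
  (* The increment f(x+s) - f(x) is at most 2N and differs from the integrated cubic by at most 57 v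
     + c; thus 1772987 = 2 + 57 + 1772928. Since x <= 1/2, the range s <= 1/4 stays inside
     [0,3/4]. *)
  set (e := 1772987 * M).
  assert (EQ : forall s, 0 <= s <= 1 / 4 ->
            Rabs (p x * s + p1 x / 2 * s ^ 2 + p2 x / 6 * s ^ 3) <= e).
  { intros s Hs.
    assert (A : Rabs ((f (x + s) - p x * (x + s - x) - p1 x / 2 * (x + s - x) ^ 2
                       - p2 x / 6 * (x + s - x) ^ 3)
                      - (f x - p x * (x - x) - p1 x / 2 * (x - x) ^ 2
                       - p2 x / 6 * (x - x) ^ 3))
                <= 57 * w * Rabs (x + s - x) + c * Rabs (x + s - x) ^ 4).
    { apply (mvt_power (fun t => f t - p x * (t - x) - p1 x / 2 * (t - x) ^ 2
                       - p2 x / 6 * (t - x) ^ 3)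
             (fun t => F t - p x - p1 x * (t - x) - p2 x / 2 * (t - x) ^ 2) 0 (3 / 4));
        try assumption; try lra.
      intros t _. assert (A := Hd t). auto_derive; [now exists (F t)|].
      rewrite (is_derive_unique (fun x : R => f x) t _ A); field. }
    replace (x + s - x) with s in A by ring.
    rewrite (Rabs_pos_eq s) in A by lra.
    assert (s ^ 4 <= 1) by (rewrite <- (pow1 4); apply pow_incr; lra).
    assert (0 <= s ^ 4) by (apply pow_le; lra).
    assert (A1 := HN x ltac:(lra)). assert (A2 := HN (x + s) ltac:(lra)).
    assert (57 * w * s + c * s ^ 4 <= 57 * v + c) by nra.
    apply Rabs_le_between in A, A1, A2. apply Rabs_le_between.
    unfold e, M; unfold c in *; lra. }
  (* Solving the Vandermonde system for the values at 1/12, 1/6, 1/4 bounds the coefficients of s,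
     s^2, s^3 by 58 e, 720 e and 2016 e; the last, times 3, is the bound on [p2 x / 2]. *)
  assert (Q1 := EQ (1 / 12) ltac:(lra)). assert (Q2 := EQ (1 / 6) ltac:(lra)).
  assert (Q3 := EQ (1 / 4) ltac:(lra)).
  apply Rabs_le_between in Q1, Q2, Q3.
  assert (Ba : Rabs (p x) <= 58 * e) by (apply Rabs_le_between; lra).
  assert (Bb : Rabs (p1 x / 2) <= 720 * e) by (apply Rabs_le_between; lra).
  assert (Bc : Rabs (p2 x / 2) <= 6048 * e) by (apply Rabs_le_between; lra).
  clear Q1 Q2 Q3 EQ.
  assert (HM : N <= M /\ v <= M) by (unfold M; lra).
  assert (HFx := Hp x ltac:(lra)).
  assert (BF : Rabs (F x) <= 103000000 * M).
  { apply Rabs_le_between in HFx, Ba. apply Rabs_le_between. unfold e in *; lra. }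
  split; [unfold K; lra|].
  (* The quadratic coefficient is that of the approximant, but the linear one stays [F x]: replacing
     [p x] by it costs another 57 w, hence 114 w below. *)
  exists (p1 x / 2). split; [unfold K, e in *; lra|].
  assert (Near : forall t, 0 <= t <= 3 / 4 ->
    Rabs (f t - f x - F x * (t - x) - p1 x / 2 * (t - x) ^ 2)
      <= 114 * w * Rabs (t - x) + (c + 6048 * e) * Rabs (t - x) ^ 3).
  { intros t Ht.
    replace (f t - f x - F x * (t - x) - p1 x / 2 * (t - x) ^ 2) with
      ((f t - F x * (t - x) - p1 x / 2 * (t - x) ^ 2)
       - (f x - F x * (x - x) - p1 x / 2 * (x - x) ^ 2)) by ring.
    apply (mvt_power (fun t => f t - F x * (t - x) - p1 x / 2 * (t - x) ^ 2)
             (fun t => F t - F x - p1 x * (t - x)) 0 (3 / 4));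
      try assumption; try lra.
    - intros s _. assert (A := Hd s). auto_derive; [now exists (F s)|].
      rewrite (is_derive_unique (fun x : R => f x) s _ A); field.
    - unfold e; lra.
    - intros s Hs. assert (A := EF s Hs).
      assert (Hs1 : Rabs (s - x) <= 1) by (apply Rabs_le_between; lra).
      assert (Hs0 := Rabs_pos (s - x)).
      assert (Hq : Rabs (s - x) ^ 2 = (s - x) ^ 2) by (rewrite pow2_abs; reflexivity).
      assert (Hcube : c * Rabs (s - x) ^ 3 <= c * Rabs (s - x) ^ 2).
      { apply Rmult_le_compat_l; [assumption|]. simpl; nra. }
      assert (Hsq : Rabs (p2 x / 2 * (s - x) ^ 2) <= 6048 * e * Rabs (s - x) ^ 2).
      { rewrite Rabs_mult, Hq, (Rabs_pos_eq ((s - x) ^ 2)) by apply pow2_ge_0.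
        apply Rmult_le_compat_r; [apply pow2_ge_0 | assumption]. }
      apply Rabs_le_between in A, HFx, Hsq. apply Rabs_le_between. lra. }
  intros t Ht. assert (Hs0 := Rabs_pos (t - x)).
  assert (Hs3 : 0 <= Rabs (t - x) ^ 3) by now apply pow_le.
  assert (Hws : 0 <= w * Rabs (t - x)) by now apply Rmult_le_pos.
  destruct (Rle_dec t (3 / 4)) as [Hle | Hgt].
  - apply Rle_trans with (1 := Near t ltac:(lra)).
    assert ((c + 6048 * e) * Rabs (t - x) ^ 3 <= K * M * Rabs (t - x) ^ 3).
    { apply Rmult_le_compat_r; [assumption|]. unfold c, e, K; lra. }
    unfold K in *; lra.
  (* Beyond 3/4 there is no approximant, but |t - x| >= 1/4 turns any O(M) into O(M |t - x|^3). This
     range dictates [K], as 64 * 1500000000 < 10^11. *)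
  - assert (Hs : 1 / 4 <= t - x <= 1) by lra.
    assert (H64 : 1 <= 64 * Rabs (t - x) ^ 3).
    { rewrite Rabs_pos_eq by lra.
      assert (P := pow_incr (1 / 4) (t - x) 3 ltac:(lra)). lra. }
    assert (A1 := HN x ltac:(lra)). assert (A2 := HN t ltac:(lra)).
    assert (B1 : Rabs (F x * (t - x)) <= 103000000 * M).
    { rewrite Rabs_mult, (Rabs_pos_eq (t - x)) by lra. assert (U := Rabs_pos (F x)). nra. }
    assert (B2 : Rabs (p1 x / 2 * (t - x) ^ 2) <= 720 * e).
    { rewrite Rabs_mult, (Rabs_pos_eq ((t - x) ^ 2)) by apply pow2_ge_0.
      assert (U := Rabs_pos (p1 x / 2)). assert ((t - x) ^ 2 <= 1) by nra.
      assert (V := pow2_ge_0 (t - x)). nra. }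
    assert (T : Rabs (f t - f x - F x * (t - x) - p1 x / 2 * (t - x) ^ 2)
                <= 1500000000 * M).
    { apply Rabs_le_between in A1, A2, B1, B2. apply Rabs_le_between. unfold e in *. lra. }
    apply Rle_trans with (1 := T).
    assert (M <= 64 * (M * Rabs (t - x) ^ 3)) by nra.
    unfold K; lra.
Qed.

Lemma taylor_approx (h w N : R) (f F : R -> R) (x : R) :
  0 < h <= 1 -> 0 <= x <= 1 ->
  (forall t, is_derive f t (F t)) ->
  (forall t, 0 <= t <= 1 -> Rabs (f t) <= N) ->
  (forall t s, 0 < s <= h -> 0 <= t -> t + 3 * s <= 1 ->
     Rabs (F (t + 3 * s) - 3 * F (t + 2 * s) + 3 * F (t + s) - F t) <= w) ->
  let K := 100000000000 in let M := N + w * / h ^ 3 in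
  Rabs (F x) <= K * M /\
  exists a, Rabs a <= K * M /\
    forall t, 0 <= t <= 1 ->
      Rabs (f t - f x - F x * (t - x) - a * (t - x) ^ 2)
      <= K * (w * Rabs (t - x) + M * Rabs (t - x) ^ 3).
Proof.
  intros Hh Hx Hd HN Hw K M.
  destruct (Rle_dec x (1 / 2)) as [Hl | Hr].
  { apply taylor_approx_left; auto; lra. }
  destruct (taylor_approx_left h w N (fun t => f (1 - t)) (fun t => - F (1 - t)) (1 - x))
    as [HF [a [Ha H]]]; try lra.
  - intros t. auto_derive; [eexists; apply Hd|].
    rewrite (is_derive_unique (fun x : R => f x) (1 + - t) _ (Hd _)).
    unfold Rminus; ring.
  - intros t Ht; apply HN; lra.
  - intros t s Hs Ht Hts.
    assert (A := Hw (1 - (t + 3 * s)) s Hs ltac:(lra) ltac:(lra)).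
    replace (1 - (t + 3 * s) + 3 * s) with (1 - t) in A by ring.
    replace (1 - (t + 3 * s) + 2 * s) with (1 - (t + s)) in A by ring.
    replace (1 - (t + 3 * s) + s) with (1 - (t + 2 * s)) in A by ring.
    match goal with |- Rabs ?u <= _ => replace u with
      (F (1 - t) - 3 * F (1 - (t + s)) + 3 * F (1 - (t + 2 * s)) - F (1 - (t + 3 * s)))
      by ring end.
    assumption.
  - replace (1 - (1 - x)) with x in HF, H by ring. rewrite Rabs_Ropp in HF.
    split; [exact HF|]. exists a; split; [exact Ha|].
    intros t Ht. assert (B := H (1 - t) ltac:(lra)).
    replace (1 - (1 - t)) with t in B by ring.
    replace (Rabs (1 - t - (1 - x))) with (Rabs (t - x)) in B.
    2:{ rewrite <- Rabs_Ropp; f_equal; ring. }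
    replace (f t - f x - - F x * (1 - t - (1 - x)) - a * (1 - t - (1 - x)) ^ 2)
      with (f t - f x - F x * (t - x) - a * (t - x) ^ 2) in B by ring.
    exact B.
Qed.

(** * Beta integrals *)

(* Coquelicot lemmas leave equations typed in a structure on [R], which [ring] does not recognise. *)
Ltac eq_R := match goal with |- @eq _ ?u ?v => change (@eq R u v) end.

Lemma filter_prod_unit_ends (P : R * R -> Prop) :
  (forall a b, 0 < a < 1 / 2 -> 1 / 2 < b < 1 -> P (a, b)) ->
  filter_prod (at_right 0) (at_left 1) P.
Proof.
  intros HP.
  apply (Filter_prod _ _ _ (fun a => 0 < a < 1 / 2) (fun b => 1 / 2 < b < 1)).
  - exists (mkposreal (1 / 2) ltac:(lra)); intros y Hy Hy0.
    apply Rabs_lt_between in Hy; simpl in Hy; unfold minus, plus, opp in Hy; simpl in Hy. lra.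
  - exists (mkposreal (1 / 2) ltac:(lra)); intros y Hy Hy0.
    apply Rabs_lt_between in Hy; simpl in Hy; unfold minus, plus, opp in Hy; simpl in Hy. lra.
  - exact HP.
Qed.

Lemma is_derive_Rpower (c t : R) :
  0 < t -> is_derive (fun u => Rpower u c) t (c * Rpower t (c - 1)).
Proof. intros Ht; apply is_derive_Reals, derivable_pt_lim_power, Ht. Qed.

Lemma is_derive_Rpower_1m (c t : R) :
  t < 1 -> is_derive (fun u => Rpower (1 - u) c) t (- (c * Rpower (1 - t) (c - 1))).
Proof.
  intros Ht. evar_last.
  - apply (is_derive_comp (fun u => Rpower u c) (fun u => 1 - u)).
    + apply is_derive_Rpower; lra.
    + auto_derive; [exact I | reflexivity].
  - unfold scal; simpl; unfold mult; simpl; ring.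
Qed.

Lemma continuous_Rpower (c t : R) : 0 < t -> continuous (fun u => Rpower u c) t.
Proof.
  intros Ht; apply (ex_derive_continuous (fun u => Rpower u c)).
  eexists; now apply is_derive_Rpower.
Qed.

Lemma continuous_Rpower_1m (c t : R) : t < 1 -> continuous (fun u => Rpower (1 - u) c) t.
Proof.
  intros Ht; apply (ex_derive_continuous (fun u => Rpower (1 - u) c)).
  eexists; now apply is_derive_Rpower_1m.
Qed.

Lemma Rpower_small_at_0 (c e : R) :
  0 < c -> 0 < e -> forall u, 0 < u < Rpower e (/ c) -> Rpower u c < e.
Proof.
  intros Hc He u Hu.
  replace e with (Rpower (Rpower e (/ c)) c) at 1.
  - apply Rlt_Rpower_l; assumption.
  - rewrite Rpower_mult, Rinv_l, Rpower_1 by lra. reflexivity.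
Qed.

Lemma Rpower_le_1 (c u : R) : 0 < c -> 0 < u < 1 -> Rpower u c < 1.
Proof.
  intros Hc Hu. rewrite <- (Rpower_O u) by lra.
  unfold Rpower. apply exp_increasing.
  assert (ln u < 0) by (rewrite <- ln_1; apply ln_increasing; lra). nra.
Qed.

Lemma continuous_bounded (psi : R -> R) (a b : R) :
  a <= b -> (forall t, a <= t <= b -> continuous psi t) ->
  exists C, 0 < C /\ forall t, a <= t <= b -> Rabs (psi t) <= C.
Proof.
  intros Hab Hc.
  destruct (continuity_ab_maj (fun t => Rabs (psi t)) a b Hab) as [m [Hm _]].
  - intros t Ht. apply continuity_pt_filterlim.
    apply (continuous_comp psi Rabs t); [now apply Hc | apply continuous_Rabs].
  - exists (Rabs (psi m) + 1). split; [assert (H := Rabs_pos (psi m)); lra|].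
    intros t Ht; specialize (Hm t Ht); lra.
Qed.

(** Cauchy criterion at 0: if |psi| <= C, the integral over [u,v] is at most C v^a / a, which tends
    to 0 with v because a > 0. *)
Lemma singular_primitive_limit (a : R) (psi : R -> R) :
  0 < a -> (forall t, 0 <= t <= 1 / 2 -> continuous psi t) ->
  exists l, filterlim (fun t => RInt (fun s => psi s * Rpower s (a - 1)) (1 / 2) t)
              (at_right 0) (locally l).
Proof.
  intros Ha Hpsi.
  destruct (continuous_bounded psi 0 (1 / 2) ltac:(lra) Hpsi) as [C [HC0 HC]].
  set (g := fun s => psi s * Rpower s (a - 1)).
  assert (Hg : forall t, 0 < t <= 1 / 2 -> continuous g t).
  { intros t Ht. apply (continuous_mult psi (fun s => Rpower s (a - 1))).
    - apply Hpsi; lra.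
    - apply continuous_Rpower; lra. }
  assert (Hex : forall u v, 0 < u <= 1 / 2 -> 0 < v <= 1 / 2 -> ex_RInt g u v).
  { intros u v Hu Hv. apply (ex_RInt_continuous g). intros z Hz; apply Hg.
    revert Hz; unfold Rmin, Rmax; destruct (Rle_dec u v); lra. }
  assert (Hdiff : forall u v, 0 < u <= v -> v <= 1 / 2 ->
            Rabs (RInt g (1 / 2) v - RInt g (1 / 2) u) <= C / a * Rpower v a).
  { intros u v Hu Hv.
    assert (E : RInt g (1 / 2) v - RInt g (1 / 2) u = RInt g u v).
    { rewrite <- (RInt_Chasles g (1 / 2) u v) by (apply Hex; lra).
      unfold plus; simpl; ring. }
    rewrite E.
    apply Rle_trans with (C / a * Rpower v a - C / a * Rpower u a).
    - apply (norm_RInt_le g (fun s => C * Rpower s (a - 1)) u v); [lra | | | ].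
      + intros s Hs. unfold g. change (Rabs (psi s * Rpower s (a - 1)) <= C * Rpower s (a - 1)).
        rewrite Rabs_mult, (Rabs_pos_eq (Rpower s (a - 1))).
        * apply Rmult_le_compat_r; [left; apply exp_pos | apply HC; lra].
        * left; apply exp_pos.
      + apply (RInt_correct g), Hex; lra.
      + apply (is_RInt_derive (fun s => C / a * Rpower s a)).
        * intros s; rewrite Rmin_left, Rmax_right by lra; intros Hs.
          evar_last.
          { apply (is_derive_scal (fun s => Rpower s a) s (C / a)).
            apply is_derive_Rpower; lra. }
          unfold scal; simpl; unfold mult; simpl; field; lra.
        * intros s; rewrite Rmin_left, Rmax_right by lra; intros Hs.
          apply (continuous_scal_r C (fun s => Rpower s (a - 1))).
          apply continuous_Rpower; lra.
    - assert (0 <= C / a * Rpower u a); [|lra].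
      apply Rmult_le_pos; [|left; apply exp_pos].
      apply Rmult_le_pos; [lra | left; now apply Rinv_0_lt_compat]. }
  apply (proj1 (filterlim_locally_cauchy (F := at_right 0) (U := R_CompleteSpace)
                 (fun t => RInt g (1 / 2) t))).
  intros eps.
  assert (Hea : 0 < eps * a / C).
  { apply Rdiv_lt_0_compat; [|assumption]. apply Rmult_lt_0_compat; [apply cond_pos | assumption]. }
  (* For v below the second argument, C/a * v^a is less than [eps]; the first keeps v where [psi] is
     bounded by [C]. *)
  set (eta := Rmin (1 / 2) (Rpower (eps * a / C) (/ a))).
  assert (Heta : 0 < eta) by (apply Rmin_pos; [lra | apply exp_pos]).
  exists (fun u => 0 < u < eta). split.
  - exists (mkposreal eta Heta); intros y Hy Hy0.
    apply Rabs_lt_between in Hy; simpl in Hy; unfold minus, plus, opp in Hy; simpl in Hy. lra.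
  - assert (Hw : forall u v, 0 < u <= v -> v < eta ->
              Rabs (RInt g (1 / 2) v - RInt g (1 / 2) u) < eps).
    { intros u v Hu Hv. assert (eta <= 1 / 2) by apply Rmin_l.
      assert (Hv2 : v < Rpower (eps * a / C) (/ a)) by (apply Rlt_le_trans with (1 := Hv), Rmin_r).
      apply Rle_lt_trans with (1 := Hdiff u v Hu ltac:(lra)).
      replace (pos eps) with (C / a * (eps * a / C)) by (field; lra).
      apply Rmult_lt_compat_l.
      - now apply Rdiv_lt_0_compat.
      - apply Rpower_small_at_0; [assumption | assumption | lra]. }
    intros u v Hu Hv. change (Rabs (RInt g (1 / 2) v - RInt g (1 / 2) u) < eps).
    destruct (Rle_dec u v).
    + apply Hw; lra.
    + rewrite Rabs_minus_sym. apply Hw; lra.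
Qed.

Definition beta_weight (a b t : R) : R := Rpower t (a - 1) * Rpower (1 - t) (b - 1).

Lemma continuous_beta_weight (a b t : R) : 0 < t < 1 -> continuous (beta_weight a b) t.
Proof.
  intros Ht.
  apply (continuous_mult (fun t => Rpower t (a - 1)) (fun t => Rpower (1 - t) (b - 1))).
  - apply continuous_Rpower; lra.
  - apply continuous_Rpower_1m; lra.
Qed.

(** Basing the primitive at the interior point 1/2 separates the two singular ends, so that each
    limit can be established on its own. *)
Lemma is_RInt_gen_unit_primitive (g : R -> R) (la lb : R) :
  (forall t, 0 < t < 1 -> continuous g t) ->
  filterlim (fun t => RInt g (1 / 2) t) (at_right 0) (locally la) ->
  filterlim (fun t => RInt g (1 / 2) t) (at_left 1) (locally lb) ->
  is_RInt_gen g (at_right 0) (at_left 1) (lb - la).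
Proof.
  intros Hg Ha Hb.
  assert (HD : forall t, 0 < t < 1 -> is_derive (fun t => RInt g (1 / 2) t) t (g t)).
  { intros t Ht. apply (is_derive_RInt g (fun t => RInt g (1 / 2) t) (1 / 2)); [|now apply Hg].
    assert (Hd : 0 < Rmin t (1 - t)) by (apply Rmin_pos; lra).
    exists (mkposreal _ Hd); intros u Hu.
    apply (RInt_correct g (1 / 2) u), (ex_RInt_continuous g).
    intros z Hz; apply Hg.
    apply Rabs_lt_between in Hu; simpl in Hu; unfold minus, plus, opp in Hu; simpl in Hu.
    assert (H1 := Rmin_l t (1 - t)). assert (H2 := Rmin_r t (1 - t)).
    revert Hz; unfold Rmin at 1, Rmax; destruct (Rle_dec (1 / 2) u); lra. }
  assert (HDe : forall t, 0 < t < 1 -> Derive (fun t => RInt g (1 / 2) t) t = g t).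
  { intros t Ht; now apply is_derive_unique, HD. }
  apply is_RInt_gen_ext with (Derive (fun t => RInt g (1 / 2) t)).
  - apply filter_prod_unit_ends; intros a b Hab Hb' t; simpl.
    rewrite Rmin_left, Rmax_right by lra; intros Ht; apply HDe; lra.
  - apply is_RInt_gen_Derive; try assumption.
    + apply filter_prod_unit_ends; intros a b Hab Hb' t; simpl.
      rewrite Rmin_left, Rmax_right by lra; intros Ht; eexists; apply HD; lra.
    + apply filter_prod_unit_ends; intros a b Hab Hb' t; simpl.
      rewrite Rmin_left, Rmax_right by lra; intros Ht.
      apply (continuous_ext_loc _ g); [|apply Hg; lra].
      assert (Hd : 0 < Rmin t (1 - t)) by (apply Rmin_pos; lra).
      exists (mkposreal _ Hd); intros u Hu. symmetry; apply HDe.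
      apply Rabs_lt_between in Hu; simpl in Hu; unfold minus, plus, opp in Hu; simpl in Hu.
      assert (H1 := Rmin_l t (1 - t)). assert (H2 := Rmin_r t (1 - t)). lra.
Qed.

Lemma filterlim_1m_at_left : filterlim (fun t => 1 - t) (at_left 1) (at_right 0).
Proof.
  intros P [d Hd]. exists d; intros y Hy Hy1. apply Hd; [|lra].
  revert Hy; unfold ball; simpl; unfold AbsRing_ball, abs, minus, plus, opp; simpl.
  replace (1 - y + - 0) with (- (y + - 1)) by ring. now rewrite Rabs_Ropp.
Qed.

(** The end at 1 is reduced to the end at 0 by s -> 1 - s, which exchanges [a] and [b] and changes
    the sign of the primitive, hence the limit [- lb]. *)
Lemma beta_weight_primitive_limits (a b : R) (f : R -> R) :
  0 < a -> 0 < b -> (forall t, continuous f t) ->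
  exists la lb,
    filterlim (fun t => RInt (fun s => f s * beta_weight a b s) (1 / 2) t) (at_right 0) (locally la) /\
    filterlim (fun t => RInt (fun s => f s * beta_weight a b s) (1 / 2) t) (at_left 1) (locally lb).
Proof.
  intros Ha Hb Hf.
  destruct (singular_primitive_limit a (fun s => f s * Rpower (1 - s) (b - 1)) Ha) as [la Hla].
  { intros t Ht. apply (continuous_mult f (fun s => Rpower (1 - s) (b - 1))); [apply Hf|].
    apply continuous_Rpower_1m; lra. }
  destruct (singular_primitive_limit b (fun s => f (1 - s) * Rpower (1 - s) (a - 1)) Hb) as [lb Hlb].
  { intros t Ht.
    apply (continuous_mult (fun s => f (1 - s)) (fun s => Rpower (1 - s) (a - 1))).
    - apply (continuous_comp (fun s => 1 - s) f); [|apply Hf].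
      apply (ex_derive_continuous (fun s => 1 - s)); auto_derive; exact I.
    - apply continuous_Rpower_1m; lra. }
  exists la, (- lb). split.
  - apply filterlim_ext with (2 := Hla). intros t; apply RInt_ext; intros s _.
    unfold beta_weight.
    eq_R; ring.
  - assert (H := filterlim_comp _ _ _ _ _ _ _ _ filterlim_1m_at_left Hlb).
    assert (H' := filterlim_comp _ _ _ _ (fun y : R => opp y) _ _ _ H (filterlim_opp lb)).
    apply filterlim_ext_loc with (2 := H').
    exists (mkposreal (1 / 2) ltac:(lra)); intros t Ht Ht1.
    apply Rabs_lt_between in Ht; simpl in Ht; unfold minus, plus, opp in Ht; simpl in Ht.
    set (G := fun s => f (1 - s) * Rpower (1 - s) (a - 1) * Rpower s (b - 1)).
    assert (E := RInt_comp G (fun s => 1 - s) (fun _ => -1) (1 / 2) t).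
    cbv beta in E. replace (1 - 1 / 2) with (1 / 2) in E by field.
    rewrite <- E.
    + rewrite (RInt_ext _ (fun s => opp (f s * beta_weight a b s))).
      2:{ intros s Hs. unfold G, beta_weight. replace (1 - (1 - s)) with s by ring.
          unfold scal, opp; simpl; unfold mult; simpl; ring. }
      rewrite (RInt_opp (V := R_CompleteNormedModule) (fun s => f s * beta_weight a b s)).
      * change opp with Ropp. apply Ropp_involutive.
      * apply (ex_RInt_continuous (fun s => f s * beta_weight a b s)).
        intros z; rewrite Rmin_left, Rmax_right by lra; intros Hz.
        apply (continuous_mult f (beta_weight a b)); [apply Hf|].
        apply continuous_beta_weight; lra.
    + intros s; rewrite Rmin_left, Rmax_right by lra; intros Hs.
      apply (continuous_mult (fun s => f (1 - s) * Rpower (1 - s) (a - 1))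
               (fun s => Rpower s (b - 1))).
      * apply (continuous_mult (fun s => f (1 - s)) (fun s => Rpower (1 - s) (a - 1))).
        -- apply (continuous_comp (fun s => 1 - s) f); [|apply Hf].
           apply (ex_derive_continuous (fun s => 1 - s)); auto_derive; exact I.
        -- apply continuous_Rpower_1m; lra.
      * apply continuous_Rpower; lra.
    + intros s Hs; split; [auto_derive; [exact I | ring] | apply continuous_const].
Qed.

Lemma ex_RInt_gen_beta_weight (a b : R) (f : R -> R) :
  0 < a -> 0 < b -> (forall t, continuous f t) ->
  ex_RInt_gen (fun t => f t * beta_weight a b t) (at_right 0) (at_left 1).
Proof.
  intros Ha Hb Hf.
  destruct (beta_weight_primitive_limits a b f Ha Hb Hf) as [la [lb [Hla Hlb]]].
  exists (lb - la). apply is_RInt_gen_unit_primitive; [|assumption|assumption].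
  intros t Ht. apply (continuous_mult f (beta_weight a b)); [apply Hf|].
  now apply continuous_beta_weight.
Qed.

Lemma is_RInt_gen_Beta (a b : R) :
  0 < a -> 0 < b -> is_RInt_gen (beta_weight a b) (at_right 0) (at_left 1) (Beta a b).
Proof.
  intros Ha Hb. apply (RInt_gen_correct (beta_weight a b)).
  apply (ex_RInt_gen_ext_eq (fun t => 1 * beta_weight a b t)); [intros t; apply Rmult_1_l|].
  apply (ex_RInt_gen_beta_weight a b (fun _ => 1)); auto. intros t; apply continuous_const.
Qed.

(** Strictness must survive the limits: the primitive from 1/2 has limit at most 0 at 0, while its
    limit at 1 is at least its positive value at 3/4. *)
Lemma Beta_pos (a b : R) : 0 < a -> 0 < b -> 0 < Beta a b.
Proof.
  intros Ha Hb.
  destruct (beta_weight_primitive_limits a b (fun _ => 1) Ha Hb) as [la [lb [Hla Hlb]]].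
  { intros t; apply continuous_const. }
  set (g := fun s => 1 * beta_weight a b s) in *.
  assert (Hpos : forall t, 0 < g t).
  { intros t; unfold g, beta_weight. rewrite Rmult_1_l.
    apply Rmult_lt_0_compat; apply exp_pos. }
  assert (Hg : forall t, 0 < t < 1 -> continuous g t).
  { intros t Ht. apply (continuous_mult (fun _ => 1) (beta_weight a b)).
    - apply continuous_const.
    - now apply continuous_beta_weight. }
  assert (HB : Beta a b = lb - la).
  { unfold Beta. apply (is_RInt_gen_unique (V := R_CompleteNormedModule)).
    apply is_RInt_gen_ext with g.
    - apply filter_prod_unit_ends; intros; apply Rmult_1_l.
    - now apply is_RInt_gen_unit_primitive. }
  assert (Hex : forall u v, 0 < u < 1 -> 0 < v < 1 -> ex_RInt g u v).
  { intros u v Hu Hv. apply (ex_RInt_continuous g). intros z Hz; apply Hg.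
    revert Hz; unfold Rmin, Rmax; destruct (Rle_dec u v); lra. }
  assert (Hl0 : la <= 0).
  { apply (filterlim_le (F := at_right 0) (fun t => RInt g (1 / 2) t) (fun _ => 0) la 0).
    - exists (mkposreal (1 / 2) ltac:(lra)); intros t Ht Ht1.
      apply Rabs_lt_between in Ht; simpl in Ht; unfold minus, plus, opp in Ht; simpl in Ht.
      rewrite <- opp_RInt_swap by (apply Hex; lra).
      assert (0 < RInt g t (1 / 2)).
      { apply RInt_gt_0; [lra | intros; apply Hpos | intros; apply Hg; lra]. }
      unfold opp; simpl; lra.
    - exact Hla.
    - apply filterlim_const. }
  assert (H1 : 0 < RInt g (1 / 2) (3 / 4)).
  { apply RInt_gt_0; [lra | intros; apply Hpos | intros; apply Hg; lra]. }
  assert (Hl1 : RInt g (1 / 2) (3 / 4) <= lb).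
  { apply (filterlim_le (F := at_left 1) (fun _ => RInt g (1 / 2) (3 / 4))
             (fun t => RInt g (1 / 2) t) (RInt g (1 / 2) (3 / 4)) lb).
    - exists (mkposreal (1 / 4) ltac:(lra)); intros t Ht Ht1.
      apply Rabs_lt_between in Ht; simpl in Ht; unfold minus, plus, opp in Ht; simpl in Ht.
      rewrite <- (RInt_Chasles g (1 / 2) (3 / 4) t) by (apply Hex; lra).
      assert (0 < RInt g (3 / 4) t).
      { apply RInt_gt_0; [lra | intros; apply Hpos | intros; apply Hg; lra]. }
      unfold plus; simpl; lra.
    - apply filterlim_const.
    - exact Hlb. }
  lra.
Qed.

(* Integrates the derivative of [t^a (1-t)^b], which is [(a - (a+b) t) t^(a-1) (1-t)^(b-1)]. *)
Lemma Beta_succ_l (a b : R) :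
  0 < a -> 0 < b -> (a + b) * Beta (a + 1) b = a * Beta a b.
Proof.
  intros Ha Hb.
  set (Phi := fun t => Rpower t a * Rpower (1 - t) b).
  set (dPhi := fun t => a * beta_weight a b t - (a + b) * beta_weight (a + 1) b t).
  assert (HD : forall t, 0 < t < 1 -> is_derive Phi t (dPhi t)).
  { intros t Ht. unfold Phi. evar_last.
    - apply (is_derive_mult (fun t => Rpower t a) (fun t => Rpower (1 - t) b)).
      + apply is_derive_Rpower; lra.
      + apply is_derive_Rpower_1m; lra.
      + intros; apply Rmult_comm.
    - unfold plus, mult; simpl. unfold dPhi, beta_weight.
      replace (a + 1 - 1) with (1 + (a - 1)) by ring.
      replace (Rpower t a) with (Rpower t (1 + (a - 1))) by (f_equal; ring).
      replace (Rpower (1 - t) b) with (Rpower (1 - t) (1 + (b - 1))) by (f_equal; ring).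
      rewrite !Rpower_plus, !Rpower_1 by lra. ring. }
  assert (HC : forall t, 0 < t < 1 -> continuous dPhi t).
  { intros t Ht. apply (continuous_minus (fun t => a * beta_weight a b t)
                          (fun t => (a + b) * beta_weight (a + 1) b t)).
    - apply (continuous_scal_r a (beta_weight a b)); now apply continuous_beta_weight.
    - apply (continuous_scal_r (a + b) (beta_weight (a + 1) b)); now apply continuous_beta_weight. }
  assert (HI0 : is_RInt_gen dPhi (at_right 0) (at_left 1) (0 - 0)).
  { apply is_RInt_gen_ext with (Derive Phi).
    - apply filter_prod_unit_ends; intros u v Hu Hv t; simpl.
      rewrite Rmin_left, Rmax_right by lra; intros Ht.
      apply is_derive_unique, HD; lra.
    - apply is_RInt_gen_Derive.
      + apply filter_prod_unit_ends; intros u v Hu Hv t; simpl.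
        rewrite Rmin_left, Rmax_right by lra; intros Ht; eexists; apply HD; lra.
      + apply filter_prod_unit_ends; intros u v Hu Hv t; simpl.
        rewrite Rmin_left, Rmax_right by lra; intros Ht.
        apply (continuous_ext_loc _ dPhi); [|apply HC; lra].
        assert (Hd : 0 < Rmin t (1 - t)) by (apply Rmin_pos; lra).
        exists (mkposreal _ Hd); intros s Hs. symmetry; apply is_derive_unique, HD.
        apply Rabs_lt_between in Hs; simpl in Hs; unfold minus, plus, opp in Hs; simpl in Hs.
        assert (H1 := Rmin_l t (1 - t)). assert (H2 := Rmin_r t (1 - t)). lra.
      (* Both boundary terms vanish because [a] and [b] are positive: near each end one factor is
         below [eps] and the other below 1. *)
      + apply filterlim_locally; intros eps.
        assert (Hd : 0 < Rmin 1 (Rpower eps (/ a))) by (apply Rmin_pos; [lra | apply exp_pos]).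
        exists (mkposreal _ Hd); intros s Hs Hs0.
        apply Rabs_lt_between in Hs; simpl in Hs; unfold minus, plus, opp in Hs; simpl in Hs.
        assert (H1 := Rmin_l 1 (Rpower eps (/ a))). assert (H2 := Rmin_r 1 (Rpower eps (/ a))).
        assert (B1 := Rpower_small_at_0 a eps Ha (cond_pos eps) s ltac:(lra)).
        assert (B2 := Rpower_le_1 b (1 - s) Hb ltac:(lra)).
        assert (P1 : 0 < Rpower s a) by apply exp_pos.
        assert (P2 : 0 < Rpower (1 - s) b) by apply exp_pos.
        change (Rabs (Phi s - 0) < eps). unfold Phi.
        rewrite Rminus_0_r, Rabs_pos_eq by (apply Rmult_le_pos; lra). nra.
      + apply filterlim_locally; intros eps.
        assert (Hd : 0 < Rmin 1 (Rpower eps (/ b))) by (apply Rmin_pos; [lra | apply exp_pos]).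
        exists (mkposreal _ Hd); intros s Hs Hs0.
        apply Rabs_lt_between in Hs; simpl in Hs; unfold minus, plus, opp in Hs; simpl in Hs.
        assert (H1 := Rmin_l 1 (Rpower eps (/ b))). assert (H2 := Rmin_r 1 (Rpower eps (/ b))).
        assert (B1 := Rpower_small_at_0 b eps Hb (cond_pos eps) (1 - s) ltac:(lra)).
        assert (B2 := Rpower_le_1 a s Ha ltac:(lra)).
        assert (P1 : 0 < Rpower s a) by apply exp_pos.
        assert (P2 : 0 < Rpower (1 - s) b) by apply exp_pos.
        change (Rabs (Phi s - 0) < eps). unfold Phi.
        rewrite Rminus_0_r, Rabs_pos_eq by (apply Rmult_le_pos; lra). nra. }
  assert (HI1 : is_RInt_gen dPhi (at_right 0) (at_left 1)
                  (a * Beta a b - (a + b) * Beta (a + 1) b)).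
  { apply (is_RInt_gen_minus (fun t => a * beta_weight a b t)
             (fun t => (a + b) * beta_weight (a + 1) b t)).
    - apply (is_RInt_gen_scal (beta_weight a b) a), is_RInt_gen_Beta; assumption.
    - apply (is_RInt_gen_scal (beta_weight (a + 1) b) (a + b)), is_RInt_gen_Beta; lra. }
  apply (is_RInt_gen_unique (V := R_CompleteNormedModule)) in HI0, HI1.
  rewrite HI0 in HI1. lra.
Qed.

(** * Nodes, binomial expectations and moments *)

(** The mean of [f] under the Beta law with parameters k rho and (n-k) rho, completed by point
    masses at 0 and 1 for k = 0 and k = n, where the density has no meaning. The two end terms of
    [U] thereby join the sum. *)
Definition node (rho : R) (n k : nat) (f : R -> R) : R :=
  if Nat.eqb k 0 then f 0
  else if Nat.eqb k n then f 1
  else RInt_gen (fun t => f t * mu rho n k t) (at_right 0) (at_left 1).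

Lemma pnk_0 (n : nat) (x : R) : pnk n 0 x = (1 - x) ^ n.
Proof. unfold pnk. rewrite C_n_0, Nat.sub_0_r. simpl; ring. Qed.

Lemma pnk_n (n : nat) (x : R) : pnk n n x = x ^ n.
Proof. unfold pnk. rewrite C_n_n, Nat.sub_diag. simpl; ring. Qed.

Lemma pnk_nonneg (n k : nat) (x : R) : 0 <= x <= 1 -> 0 <= pnk n k x.
Proof.
  intros Hx. unfold pnk, Binomial.C.
  assert (P := INR_fact_lt_0).
  repeat apply Rmult_le_pos; try (apply pow_le; lra); try (left; apply P).
  left; apply Rinv_0_lt_compat, Rmult_lt_0_compat; apply P.
Qed.

Lemma pnk_succ (n k : nat) (x : R) :
  (k < n)%nat ->
  pnk (S n) (S k) x = (1 - x) * pnk n (S k) x + x * pnk n k x.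
Proof.
  intros Hk. unfold pnk.
  rewrite <- (pascal n k Hk).
  replace (S n - S k)%nat with (S (n - S k)) by lia.
  replace (n - k)%nat with (S (n - S k)) by lia.
  simpl; ring.
Qed.

(** Expectation of phi(k) for k binomially distributed with parameters [n] and [x]. *)
Definition binexp (n : nat) (x : R) (phi : nat -> R) : R :=
  sum_n_m (fun k => phi k * pnk n k x) 0 n.

(** The condition on [n] keeps the end indices 0 and n distinct: at n = 0 the operator yields
    [f 0 + f 1], whereas the expectation has a single term. At n = 1 the sum of integrals is
    empty. *)
Lemma U_binexp (rho : R) (n : nat) (f : R -> R) (x : R) :
  (1 <= n)%nat -> U rho n f x = binexp n x (fun k => node rho n k f).
Proof.
  intros Hn. unfold U, binexp.
  destruct n as [|m]; [lia|].
  rewrite (sum_Sn_m (fun k => node rho (S m) k f * pnk (S m) k x) 0 (S m)) by lia.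
  rewrite (sum_n_Sm (fun k => node rho (S m) k f * pnk (S m) k x) 1 m) by lia.
  rewrite pnk_0, pnk_n. simpl (S m - 1)%nat. rewrite Nat.sub_0_r.
  unfold node at 1 3. simpl (Nat.eqb 0 0). simpl (Nat.eqb (S m) 0). rewrite Nat.eqb_refl.
  cbv iota.
  rewrite (sum_n_m_ext_loc (fun k => node rho (S m) k f * pnk (S m) k x)
     (fun k => RInt_gen (fun t => f t * mu rho (S m) k t) (at_right 0) (at_left 1)
               * pnk (S m) k x)).
  - unfold plus; simpl; eq_R; ring.
  - intros k Hk. unfold node.
    rewrite (proj2 (Nat.eqb_neq k 0)), (proj2 (Nat.eqb_neq k (S m))) by lia. reflexivity.
Qed.

Lemma binexp_ext (n : nat) (x : R) (phi psi : nat -> R) :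
  (forall k, (k <= n)%nat -> phi k = psi k) -> binexp n x phi = binexp n x psi.
Proof. intros H. apply sum_n_m_ext_loc. intros k Hk; rewrite H by lia; reflexivity. Qed.

Lemma binexp_linear (n : nat) (x c : R) (phi psi : nat -> R) :
  binexp n x (fun k => phi k + c * psi k) = binexp n x phi + c * binexp n x psi.
Proof.
  unfold binexp.
  rewrite <- (sum_n_m_mult_l (K := R_Ring) c (fun k => psi k * pnk n k x)).
  rewrite <- (sum_n_m_plus (G := R_AbelianMonoid) (fun k => phi k * pnk n k x)).
  apply sum_n_m_ext; intros k. unfold plus, mult; simpl; eq_R; ring.
Qed.

Lemma binexp_nonneg (n : nat) (x : R) (phi : nat -> R) :
  0 <= x <= 1 -> (forall k, (k <= n)%nat -> 0 <= phi k) -> 0 <= binexp n x phi.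
Proof.
  intros Hx H. unfold binexp.
  replace 0 with (sum_n_m (fun _ : nat => 0) 0 n).
  2:{ rewrite sum_n_m_const. eq_R; ring. }
  rewrite (sum_n_m_ext_loc (fun k => phi k * pnk n k x)
             (fun k => if Nat.leb k n then phi k * pnk n k x else 0)).
  - apply sum_n_m_le. intros k. destruct (Nat.leb_spec k n) as [Hk|Hk]; [|lra].
    apply Rmult_le_pos; [now apply H | now apply pnk_nonneg].
  - intros k Hk. rewrite (proj2 (Nat.leb_le k n)) by lia. reflexivity.
Qed.

(** Conditioning on the last of n + 1 trials; Pascal's rule is the underlying identity. *)
Lemma binexp_succ (n : nat) (x : R) (phi : nat -> R) :
  binexp (S n) x phi = (1 - x) * binexp n x phi + x * binexp n x (fun k => phi (S k)).
Proof.
  assert (E1 : binexp n x phi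
    = phi 0%nat * (1 - x) ^ n + sum_n_m (fun k => phi k * pnk n k x) 1 n).
  { unfold binexp. rewrite sum_Sn_m by lia. rewrite pnk_0. reflexivity. }
  assert (E2 : binexp n x (fun k => phi (S k))
    = sum_n_m (fun k => phi k * pnk n (pred k) x) 1 n + phi (S n) * x ^ n).
  { unfold binexp.
    transitivity (sum_n_m (fun k => phi k * pnk n (pred k) x) 1 (S n)).
    { apply (sum_n_m_S (fun k => phi k * pnk n (pred k) x) 0 n). }
    rewrite sum_n_Sm by lia. simpl pred. rewrite pnk_n. reflexivity. }
  rewrite E1, E2. unfold binexp. rewrite sum_Sn_m, sum_n_Sm by lia.
  rewrite pnk_0, pnk_n.
  rewrite (sum_n_m_ext_loc (fun k => phi k * pnk (S n) k x)
    (fun k => plus (mult (1 - x) (phi k * pnk n k x)) (mult x (phi k * pnk n (pred k) x)))).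
  - rewrite (sum_n_m_plus (G := R_AbelianMonoid) (fun k => mult (1 - x) (phi k * pnk n k x))
               (fun k => mult x (phi k * pnk n (pred k) x))).
    rewrite (sum_n_m_mult_l (K := R_Ring) (1 - x) (fun k => phi k * pnk n k x)).
    rewrite (sum_n_m_mult_l (K := R_Ring) x (fun k => phi k * pnk n (pred k) x)).
    set (s1 := sum_n_m (fun k => phi k * pnk n k x) 1 n).
    set (s2 := sum_n_m (fun k => phi k * pnk n (pred k) x) 1 n).
    change (phi 0%nat * (1 - x) ^ S n + ((1 - x) * s1 + x * s2 + phi (S n) * x ^ S n)
      = (1 - x) * (phi 0%nat * (1 - x) ^ n + s1) + x * (s2 + phi (S n) * x ^ n)).
    simpl; ring.
  - intros k Hk. destruct k as [|k]; [lia|]. rewrite pnk_succ by lia.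
    unfold plus, mult; simpl; eq_R; ring.
Qed.

(** Induction by conditioning on the last trial, which requires only the moments of k + 1, expanded
    by the binomial formula. The coefficients 1, 3, 1 and 1, 6, 7, 1 are Stirling numbers of the
    second kind. Degree four suffices for the fourth central moment. *)
Lemma binexp_moments (n : nat) (x : R) :
  let N := INR n in let E := binexp n x in
  E (fun _ => 1) = 1 /\
  E (fun k => INR k) = N * x /\
  E (fun k => INR k ^ 2) = N * (N - 1) * x ^ 2 + N * x /\
  E (fun k => INR k ^ 3)
    = N * (N - 1) * (N - 2) * x ^ 3 + 3 * N * (N - 1) * x ^ 2 + N * x /\
  E (fun k => INR k ^ 4)
    = N * (N - 1) * (N - 2) * (N - 3) * x ^ 4 + 6 * N * (N - 1) * (N - 2) * x ^ 3
      + 7 * N * (N - 1) * x ^ 2 + N * x.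
Proof.
  induction n as [|n IH]; cbv zeta.
  - unfold binexp. rewrite !sum_n_n. unfold pnk, Binomial.C. simpl. repeat split; field.
  - destruct IH as [I0 [I1 [I2 [I3 I4]]]].
    change (binexp n x INR = INR n * x) in I1.
    assert (L1 : binexp n x (fun k => INR (S k)) = INR n * x + 1).
    { rewrite (binexp_ext n x _ (fun k => INR k + 1 * 1)) by (intros; rewrite S_INR; ring).
      rewrite binexp_linear, I0, I1; ring. }
    assert (L2 : binexp n x (fun k => INR (S k) ^ 2)
      = INR n * (INR n - 1) * x ^ 2 + INR n * x + 2 * (INR n * x) + 1).
    { rewrite (binexp_ext n x _ (fun k => INR k ^ 2 + 2 * INR k + 1 * 1))
        by (intros; rewrite S_INR; ring).
      rewrite !binexp_linear, I0, I1, I2; ring. }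
    assert (L3 : binexp n x (fun k => INR (S k) ^ 3)
      = binexp n x (fun k => INR k ^ 3) + 3 * binexp n x (fun k => INR k ^ 2)
        + 3 * binexp n x INR + 1 * binexp n x (fun _ => 1)).
    { rewrite <- !binexp_linear. apply binexp_ext; intros; rewrite S_INR; ring. }
    assert (L4 : binexp n x (fun k => INR (S k) ^ 4)
      = binexp n x (fun k => INR k ^ 4) + 4 * binexp n x (fun k => INR k ^ 3)
        + 6 * binexp n x (fun k => INR k ^ 2)
        + 4 * binexp n x INR + 1 * binexp n x (fun _ => 1)).
    { rewrite <- !binexp_linear. apply binexp_ext; intros; rewrite S_INR; ring. }
    rewrite !binexp_succ.
    change (binexp n x (fun k => INR k)) with (binexp n x INR).
    rewrite L1, L2, L3, L4, I0, I1, I2, I3, I4, S_INR.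
    repeat split; ring.
Qed.

(** * Integrals and moments under the Beta laws at the nodes *)

Lemma mu_params_pos (rho : R) (n k : nat) :
  0 < rho -> (1 <= k < n)%nat -> 0 < INR k * rho /\ 0 < INR (n - k) * rho.
Proof.
  intros Hr Hk. split; apply Rmult_lt_0_compat; try assumption; apply lt_0_INR; lia.
Qed.

Lemma is_RInt_gen_mu (rho : R) (n k : nat) (f : R -> R) :
  0 < rho -> (1 <= k < n)%nat -> (forall t, continuous f t) ->
  is_RInt_gen (fun t => f t * mu rho n k t) (at_right 0) (at_left 1)
    (RInt_gen (fun t => f t * mu rho n k t) (at_right 0) (at_left 1)).
Proof.
  intros Hr Hk Hf. destruct (mu_params_pos rho n k Hr Hk) as [Ha Hb].
  apply (RInt_gen_correct (fun t => f t * mu rho n k t)).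
  destruct (ex_RInt_gen_beta_weight _ _ f Ha Hb Hf) as [l Hl].
  exists (scal (/ Beta (INR k * rho) (INR (n - k) * rho)) l).
  apply is_RInt_gen_ext with (2 := is_RInt_gen_scal _ (/ Beta (INR k * rho) (INR (n - k) * rho)) l Hl).
  apply filter_prod_unit_ends; intros u v _ _ t _.
  unfold mu, beta_weight, scal; simpl; unfold mult; simpl; unfold Rdiv; eq_R; ring.
Qed.

Lemma node_linear (rho : R) (n k : nat) (c : R) (f g : R -> R) :
  0 < rho -> (k <= n)%nat -> (forall t, continuous f t) -> (forall t, continuous g t) ->
  node rho n k (fun t => f t + c * g t) = node rho n k f + c * node rho n k g.
Proof.
  intros Hr Hk Hf Hg. unfold node.
  destruct (Nat.eqb_spec k 0) as [|H0]; [reflexivity|].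
  destruct (Nat.eqb_spec k n) as [|Hn]; [reflexivity|].
  apply (is_RInt_gen_unique (V := R_CompleteNormedModule)).
  assert (If := is_RInt_gen_mu rho n k f Hr ltac:(lia) Hf).
  assert (Ig := is_RInt_gen_mu rho n k g Hr ltac:(lia) Hg).
  apply is_RInt_gen_ext with (2 := is_RInt_gen_plus _ _ _ _ If (is_RInt_gen_scal _ c _ Ig)).
  apply filter_prod_unit_ends; intros u v _ _ t _.
  unfold plus, scal; simpl; unfold mult; simpl; eq_R; ring.
Qed.

Lemma mu_nonneg (rho : R) (n k : nat) (t : R) :
  0 < rho -> (1 <= k < n)%nat -> 0 <= mu rho n k t.
Proof.
  intros Hr Hk. destruct (mu_params_pos rho n k Hr Hk) as [Ha Hb].
  assert (HB := Beta_pos _ _ Ha Hb).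
  unfold mu. apply Rmult_le_pos; [|left; now apply Rinv_0_lt_compat].
  left; apply Rmult_lt_0_compat; apply exp_pos.
Qed.

Lemma node_nonneg (rho : R) (n k : nat) (f : R -> R) :
  0 < rho -> (k <= n)%nat -> (forall t, continuous f t) ->
  (forall t, 0 <= t <= 1 -> 0 <= f t) -> 0 <= node rho n k f.
Proof.
  intros Hr Hk Hf H. unfold node.
  destruct (Nat.eqb_spec k 0) as [|H0]; [apply H; lra|].
  destruct (Nat.eqb_spec k n) as [|Hn]; [apply H; lra|].
  assert (If := is_RInt_gen_mu rho n k f Hr ltac:(lia) Hf).
  (* A nonnegative integrand dominates its own norm, so the integral l satisfies |l| <= l. *)
  match type of If with is_RInt_gen _ _ _ ?l =>
    apply Rle_trans with (Rabs l); [apply Rabs_pos|] end.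
  apply (fun A B => RInt_gen_norm _ _ _ _ A B If If).
  - apply filter_prod_unit_ends; intros u v Hu Hv; simpl; lra.
  - apply filter_prod_unit_ends; intros u v Hu Hv t; simpl; intros Ht.
    right. change (Rabs (f t * mu rho n k t) = f t * mu rho n k t). apply Rabs_pos_eq.
    apply Rmult_le_pos; [apply H; lra | apply mu_nonneg; [assumption | lia]].
Qed.

Lemma node_ext (rho : R) (n k : nat) (f g : R -> R) :
  0 < rho -> (k <= n)%nat -> (forall t, continuous f t) ->
  (forall t, 0 <= t <= 1 -> f t = g t) -> node rho n k f = node rho n k g.
Proof.
  intros Hr Hk Hf H. unfold node.
  destruct (Nat.eqb_spec k 0) as [|H0]; [apply H; lra|].
  destruct (Nat.eqb_spec k n) as [|Hn]; [apply H; lra|].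
  symmetry; apply (is_RInt_gen_unique (V := R_CompleteNormedModule)).
  apply is_RInt_gen_ext with (2 := is_RInt_gen_mu rho n k f Hr ltac:(lia) Hf).
  apply filter_prod_unit_ends; intros u v Hu Hv t; simpl.
  rewrite Rmin_left, Rmax_right by lra; intros Ht. rewrite H by lra. reflexivity.
Qed.

Lemma node_pow (rho : R) (n k j : nat) :
  0 < rho -> (1 <= k < n)%nat ->
  node rho n k (fun t => t ^ j)
  = Beta (INR k * rho + INR j) (INR (n - k) * rho) / Beta (INR k * rho) (INR (n - k) * rho).
Proof.
  intros Hr Hk. destruct (mu_params_pos rho n k Hr Hk) as [Ha Hb].
  unfold node.
  rewrite (proj2 (Nat.eqb_neq k 0)), (proj2 (Nat.eqb_neq k n)) by lia.
  apply (is_RInt_gen_unique (V := R_CompleteNormedModule)).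
  assert (Haj : 0 < INR k * rho + INR j) by (assert (P := pos_INR j); lra).
  assert (I := is_RInt_gen_scal _ (/ Beta (INR k * rho) (INR (n - k) * rho)) _
                 (is_RInt_gen_Beta _ _ Haj Hb)).
  replace (_ / _) with (scal (/ Beta (INR k * rho) (INR (n - k) * rho))
             (Beta (INR k * rho + INR j) (INR (n - k) * rho)))
    by (unfold scal; simpl; unfold mult; simpl; unfold Rdiv; eq_R; ring).
  apply is_RInt_gen_ext with (2 := I).
  apply filter_prod_unit_ends; intros u v Hu Hv t; simpl.
  rewrite Rmin_left, Rmax_right by lra; intros Ht.
  unfold mu, beta_weight, scal; simpl; unfold mult; simpl.
  replace (INR k * rho + INR j - 1) with (INR j + (INR k * rho - 1)) by ring.
  rewrite Rpower_plus, Rpower_pow by lra. unfold Rdiv; eq_R; ring.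
Qed.

Lemma node_one (rho : R) (n k : nat) :
  0 < rho -> (k <= n)%nat -> node rho n k (fun _ => 1) = 1.
Proof.
  intros Hr Hk.
  destruct (Nat.eq_dec k 0) as [->|H0]; [reflexivity|].
  destruct (Nat.eq_dec k n) as [->|Hn].
  { unfold node. rewrite Nat.eqb_refl. now destruct (Nat.eqb n 0). }
  destruct (mu_params_pos rho n k Hr ltac:(lia)) as [Ha Hb].
  assert (E := node_pow rho n k 0 Hr ltac:(lia)). simpl in E.
  rewrite E, Rplus_0_r. field. apply Rgt_not_eq, Beta_pos; assumption.
Qed.

(** For interior [k] this is the recursion of the Beta function. At k = 0 both sides vanish and at k
    = n they coincide, so moments at all nodes follow from one formula, a quotient of rising
    factorials. *)
Lemma node_pow_succ (rho : R) (n k j : nat) :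
  0 < rho -> (1 <= n)%nat -> (k <= n)%nat ->
  (INR n * rho + INR j) * node rho n k (fun t => t ^ S j)
  = (INR k * rho + INR j) * node rho n k (fun t => t ^ j).
Proof.
  intros Hr Hn Hk.
  destruct (Nat.eq_dec k 0) as [->|H0].
  { unfold node; simpl. destruct j; simpl; ring. }
  destruct (Nat.eq_dec k n) as [->|Hkn].
  { unfold node. rewrite Nat.eqb_refl, (proj2 (Nat.eqb_neq n 0)) by lia.
    rewrite !pow1; ring. }
  rewrite !node_pow by (assumption || lia).
  destruct (mu_params_pos rho n k Hr ltac:(lia)) as [Ha Hb].
  assert (B := Beta_succ_l (INR k * rho + INR j) (INR (n - k) * rho)
                 ltac:(assert (P := pos_INR j); lra) Hb).
  rewrite minus_INR in B by lia. rewrite minus_INR by lia.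
  rewrite S_INR.
  replace (INR k * rho + (INR j + 1)) with (INR k * rho + INR j + 1) by ring.
  replace (INR k * rho + INR j + (INR n - INR k) * rho) with (INR n * rho + INR j) in B by ring.
  unfold Rdiv. rewrite <- !Rmult_assoc, B. reflexivity.
Qed.

(** * Covariances under positive linear functionals *)

Lemma continuous_everywhere_lin (c : R) (u v : R -> R) :
  (forall t : R, continuous u t) -> (forall t : R, continuous v t) ->
  forall t : R, continuous (fun t => u t + c * v t) t.
Proof.
  intros Hu Hv t. apply (continuous_plus u (fun t => c * v t)); [apply Hu|].
  apply (continuous_scal_r c v), Hv.
Qed.

Lemma continuous_everywhere_mult (u v : R -> R) :
  (forall t : R, continuous u t) -> (forall t : R, continuous v t) ->
  forall t : R, continuous (fun t => u t * v t) t.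
Proof. intros Hu Hv t. apply (continuous_mult u v); [apply Hu | apply Hv]. Qed.

Lemma continuous_everywhere_shift (x t : R) : continuous (fun t : R => t - x) t.
Proof. apply (ex_derive_continuous (fun t => t - x)); auto_derive; exact I. Qed.

Lemma continuous_everywhere_pow (x : R) (k : nat) (t : R) : continuous (fun t : R => (t - x) ^ k) t.
Proof. apply (ex_derive_continuous (fun t => (t - x) ^ k)); auto_derive; exact I. Qed.

Lemma continuous_everywhere_abs (x t : R) : continuous (fun t : R => Rabs (t - x)) t.
Proof.
  apply (continuous_comp (fun t => t - x) Rabs);
    [apply continuous_everywhere_shift | apply continuous_Rabs].
Qed.

(** Directed by syntax: integrands are kept in the shape [u + c * v] in which linearity of the
    functional is stated, which explains spelled-out forms such as [(- f x) * 1] below. *)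
Ltac cont :=
  lazymatch goal with
  | |- forall t, continuous (fun _ => ?c) t => intros ?; apply continuous_const
  | |- forall t, continuous (fun s => s - ?x) t => exact (continuous_everywhere_shift x)
  | |- forall t, continuous (fun s => (s - ?x) ^ ?k) t => exact (continuous_everywhere_pow x k)
  | |- forall t, continuous (fun s => Rabs (s - ?x)) t => exact (continuous_everywhere_abs x)
  | |- forall t, continuous (fun s => @?u s + ?c * @?v s) t =>
      apply (continuous_everywhere_lin c u v); cont
  | |- forall t, continuous (fun s => @?u s * @?v s) t =>
      apply (continuous_everywhere_mult u v); cont
  | |- _ => assumption
  end.

Lemma Rmult_Rabs_le (a b A B : R) : Rabs a <= A -> Rabs b <= B -> Rabs (a * b) <= A * B.
Proof.
  intros Ha Hb. rewrite Rabs_mult.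
  apply Rmult_le_compat; try apply Rabs_pos; assumption.
Qed.

Lemma Rabs_plus_le (a b A B : R) : Rabs a <= A -> Rabs b <= B -> Rabs (a + b) <= A + B.
Proof. intros Ha Hb. apply Rle_trans with (1 := Rabs_triang _ _). lra. Qed.

(** In F s r the bound |F| <= N is used against [w] and |F| <= K M against [M']. In a s^2 r the term
    M w |s|^3 is at most M M' q |s|^3, which 2 q |s|^3 <= q^2 s^2 + s^4 splits; the term in |s|^5 is
    at most s^4. The s^4 contributions add up to 1 + 1 + 1/2. *)
Lemma cross_term_bound (K N w M M' q F a s r : R) :
  1 <= K -> 0 <= q <= 1 -> 0 <= w -> 0 <= M -> 0 <= M' -> Rabs s <= 1 ->
  Rabs F <= N -> Rabs F <= K * M -> Rabs a <= K * M -> w <= q * M' ->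
  Rabs r <= K * (w * Rabs s + M' * Rabs s ^ 3) ->
  Rabs ((F * s + a * s ^ 2) * r)
  <= K ^ 2 * ((N * w + q ^ 2 * (M * M') / 2) * s ^ 2 + 5 / 2 * (M * M') * s ^ 4).
Proof.
  intros HK Hq Hw HM HM' Hs HN HF Ha Hwq Hr.
  assert (E2 : s ^ 2 = Rabs s ^ 2) by (symmetry; apply pow2_abs).
  assert (E4 : s ^ 4 = Rabs s ^ 4).
  { replace (Rabs s ^ 4) with ((Rabs s ^ 2) ^ 2) by ring. rewrite pow2_abs; ring. }
  assert (Hu := Rabs_pos s). set (u := Rabs s) in *.
  assert (HN0 : 0 <= N) by (apply Rle_trans with (2 := HN), Rabs_pos).
  assert (Hu2 : 0 <= u ^ 2) by now apply pow_le.
  assert (Hu3 : 0 <= u ^ 3) by now apply pow_le.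
  assert (Hu4 : 0 <= u ^ 4) by now apply pow_le.
  assert (HMM : 0 <= M * M') by now apply Rmult_le_pos.
  assert (HKK : K <= K ^ 2) by nra.
  assert (T1 : Rabs (F * s * r) <= K * (N * w * u ^ 2) + K ^ 2 * (M * M' * u ^ 4)).
  { rewrite !Rabs_mult. fold u.
    apply Rle_trans with (Rabs F * u * (K * (w * u + M' * u ^ 3))).
    { apply Rmult_le_compat_l; [|assumption]. apply Rmult_le_pos; [apply Rabs_pos | assumption]. }
    assert (P1 : Rabs F * (K * (w * u ^ 2)) <= N * (K * (w * u ^ 2))).
    { apply Rmult_le_compat_r; [|assumption].
      apply Rmult_le_pos; [lra | now apply Rmult_le_pos]. }
    assert (P2 : Rabs F * (K * (M' * u ^ 4)) <= K * M * (K * (M' * u ^ 4))).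
    { apply Rmult_le_compat_r; [|assumption].
      apply Rmult_le_pos; [lra | now apply Rmult_le_pos]. }
    lra. }
  assert (T2 : Rabs (a * s ^ 2 * r) <= K ^ 2 * (M * w * u ^ 3) + K ^ 2 * (M * M' * u ^ 4)).
  { rewrite !Rabs_mult, <- RPow_abs. fold u.
    apply Rle_trans with (K * M * u ^ 2 * (K * (w * u + M' * u ^ 3))).
    { apply Rmult_le_compat; try apply Rabs_pos; try assumption.
      - apply Rmult_le_pos; [apply Rabs_pos | assumption].
      - apply Rmult_le_compat_r; assumption. }
    assert (P : K ^ 2 * (M * M') * (u ^ 4 * u) <= K ^ 2 * (M * M') * u ^ 4).
    { apply Rmult_le_compat_l; [apply Rmult_le_pos; [apply pow2_ge_0 | assumption] | nra]. }
    lra. }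
  assert (T3 : M * w * u ^ 3 <= M * M' * (q ^ 2 * u ^ 2 / 2 + u ^ 4 / 2)).
  { apply Rle_trans with (M * M' * (q * u ^ 3)).
    - assert (M * u ^ 3 * w <= M * u ^ 3 * (q * M')).
      { apply Rmult_le_compat_l; [now apply Rmult_le_pos | assumption]. }
      lra.
    - apply Rmult_le_compat_l; [assumption|].
      assert (0 <= (u * (q - u)) ^ 2) by apply pow2_ge_0. lra. }
  assert (T4 : K ^ 2 * (M * w * u ^ 3)
               <= K ^ 2 * (M * M' * (q ^ 2 * u ^ 2 / 2 + u ^ 4 / 2))).
  { apply Rmult_le_compat_l; [apply pow2_ge_0 | assumption]. }
  assert (T5 : K * (N * w * u ^ 2) <= K ^ 2 * (N * w * u ^ 2)).
  { apply Rmult_le_compat_r; [|assumption].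
    apply Rmult_le_pos; [now apply Rmult_le_pos | assumption]. }
  rewrite (Rmult_plus_distr_r (F * s)).
  apply Rle_trans with (1 := Rabs_triang _ _).
  apply Rle_trans with (1 := Rplus_le_compat _ _ _ _ T1 T2). rewrite E2, E4. lra.
Qed.

(** As q <= 1, both mixed terms are at most M M' s^4, and |s|^6 <= s^4 adds a third. *)
Lemma remainder_product_bound (K w w' M M' q s r r' : R) :
  1 <= K -> 0 <= q <= 1 -> 0 <= w -> 0 <= w' -> 0 <= M -> 0 <= M' -> Rabs s <= 1 ->
  w <= q * M -> w' <= q * M' ->
  Rabs r <= K * (w * Rabs s + M * Rabs s ^ 3) ->
  Rabs r' <= K * (w' * Rabs s + M' * Rabs s ^ 3) ->
  Rabs (r * r') <= K ^ 2 * (w * w' * s ^ 2 + 3 * (M * M') * s ^ 4).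
Proof.
  intros HK Hq Hw Hw' HM HM' Hs Hwq Hwq' Hr Hr'.
  apply Rle_trans with (1 := Rmult_Rabs_le _ _ _ _ Hr Hr').
  rewrite <- (pow2_abs s). replace (s ^ 4) with (Rabs s ^ 4).
  2:{ replace (Rabs s ^ 4) with ((Rabs s ^ 2) ^ 2) by ring. rewrite pow2_abs; ring. }
  assert (Hu := Rabs_pos s). set (u := Rabs s) in *.
  assert (Hu4 : 0 <= u ^ 4) by now apply pow_le.
  assert (HwM : w <= M) by nra. assert (HwM' : w' <= M') by nra.
  assert (P1 : w * M' <= M * M') by now apply Rmult_le_compat_r.
  assert (P2 : M * w' <= M * M') by now apply Rmult_le_compat_l.
  assert (P3 : M * M' * (u ^ 4 * u ^ 2) <= M * M' * u ^ 4).
  { apply Rmult_le_compat_l; [now apply Rmult_le_pos|].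
    rewrite <- (Rmult_1_r (u ^ 4)) at 2. apply Rmult_le_compat_l; [assumption | nra]. }
  assert (P4 : (w * M' + M * w') * u ^ 4 <= 2 * (M * M') * u ^ 4).
  { apply Rmult_le_compat_r; [assumption | lra]. }
  replace (K * (w * u + M * u ^ 3) * (K * (w' * u + M' * u ^ 3)))
    with (K ^ 2 * (w * w' * u ^ 2 + (w * M' + M * w') * u ^ 4 + M * M' * (u ^ 4 * u ^ 2)))
    by ring.
  apply Rmult_le_compat_l; [apply pow2_ge_0 | lra].
Qed.

(** The constant 84 is 1 + 63 + 12 + 8: the s^2 share of the cross terms, nine times the fourth
    moment constant 7, twice the third moment constant 6, and the product of the means. Of the two
    terms w w', one comes from the product of remainders and one from the product of the means. *)
Lemma covariance_bound (E : (R -> R) -> R) (x d q K : R)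
    (f g : R -> R) (F G a b N N' w w' M M' : R) :
  (forall (c : R) (u v : R -> R), (forall t : R, continuous u t) -> (forall t : R, continuous v t) ->
     E (fun t => u t + c * v t) = E u + c * E v) ->
  (forall u : R -> R, (forall t : R, continuous u t) -> (forall t, 0 <= t <= 1 -> 0 <= u t) -> 0 <= E u) ->
  E (fun _ => 1) = 1 ->
  0 <= x <= 1 ->
  E (fun t => t - x) = 0 ->
  E (fun t => (t - x) ^ 2) = x * (1 - x) * d ->
  Rabs (E (fun t => (t - x) ^ 3)) <= 6 * (x * (1 - x)) * d ^ 2 ->
  E (fun t => (t - x) ^ 4) <= 7 * (x * (1 - x)) * d ^ 2 ->
  d = q ^ 2 -> 0 <= q <= 1 -> 1 <= K ->
  (forall t : R, continuous f t) -> (forall t : R, continuous g t) ->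
  0 <= w -> 0 <= w' -> 0 <= M -> 0 <= M' -> w <= q * M -> w' <= q * M' ->
  Rabs F <= N -> Rabs F <= K * M -> Rabs a <= K * M ->
  Rabs G <= N' -> Rabs G <= K * M' -> Rabs b <= K * M' ->
  (forall t, 0 <= t <= 1 -> Rabs (f t - f x - F * (t - x) - a * (t - x) ^ 2)
     <= K * (w * Rabs (t - x) + M * Rabs (t - x) ^ 3)) ->
  (forall t, 0 <= t <= 1 -> Rabs (g t - g x - G * (t - x) - b * (t - x) ^ 2)
     <= K * (w' * Rabs (t - x) + M' * Rabs (t - x) ^ 3)) ->
  Rabs (E (fun t => f t * g t) - E f * E g - F * G * (x * (1 - x) * d))
  <= K ^ 2 * (x * (1 - x) * d) * (N * w' + N' * w + 2 * (w * w') + 84 * (q ^ 2 * (M * M'))).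
Proof.
  intros Elin Epos E1 Hx Es1 Es2 Es3 Es4 Hd Hq HK Hf Hg Hw Hw' HM HM' Hwq Hwq'
    HFN HFM Ha HGN HGM Hb Tf Tg.
  set (zero := fun _ : R => 0).
  assert (E0 : E zero = 0).
  { assert (A := Elin (-1) (fun _ => 1) (fun _ => 1) ltac:(cont) ltac:(cont)). cbv beta in A.
    replace (1 + -1 * 1) with 0 in A by ring. fold zero in A. rewrite A; ring. }
  assert (Czero : forall t, continuous zero t) by (unfold zero; cont).
  assert (Ele : forall u v : R -> R, (forall t : R, continuous u t) -> (forall t : R, continuous v t) ->
            (forall t, 0 <= t <= 1 -> Rabs (u t) <= v t) -> Rabs (E u) <= E v).
  { intros u v Hu Hv Huv.
    assert (A1 := Epos (fun t => v t + (-1) * u t) ltac:(cont)).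
    assert (A2 := Epos (fun t => v t + 1 * u t) ltac:(cont)).
    rewrite Elin in A1, A2 by assumption.
    apply Rabs_le_between. split.
    - assert (0 <= E v + 1 * E u); [|lra]. apply A2; intros t Ht.
      assert (P := Huv t Ht). apply Rabs_le_between in P; lra.
    - assert (0 <= E v + (-1) * E u); [|lra]. apply A1; intros t Ht.
      assert (P := Huv t Ht). apply Rabs_le_between in P; lra. }
  assert (Hs1 : forall t, 0 <= t <= 1 -> Rabs (t - x) <= 1).
  { intros t Ht; apply Rabs_le_between; lra. }
  set (V := x * (1 - x) * d) in *.
  assert (HX : 0 <= x * (1 - x) <= 1) by nra.
  assert (Hd1 : 0 <= d <= 1) by (rewrite Hd; nra).
  assert (HV : 0 <= V) by (apply Rmult_le_pos; lra).
  assert (HVd : V <= d) by (unfold V; nra).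
  set (p := fun t => f t + (- f x) * 1). set (p' := fun t => g t + (- g x) * 1).
  assert (Cp : forall t, continuous p t) by (unfold p; cont).
  assert (Cp' : forall t, continuous p' t) by (unfold p'; cont).
  assert (Ef : E f = E p + f x).
  { unfold p. rewrite (Elin (- f x) f (fun _ => 1)), E1 by cont. ring. }
  assert (Eg : E g = E p' + g x).
  { unfold p'. rewrite (Elin (- g x) g (fun _ => 1)), E1 by cont. ring. }
  assert (Efg : E (fun t => f t * g t) - E f * E g = E (fun t => p t * p' t) - E p * E p').
  { replace (fun t => f t * g t) with
      (fun t => p t * p' t + f x * p' t + g x * p t + f x * g x * 1).
    2:{ apply functional_extensionality; intros t; unfold p, p'; ring. }
    rewrite (Elin _ (fun t => p t * p' t + f x * p' t + g x * p t) (fun _ => 1)),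
      (Elin _ (fun t => p t * p' t + f x * p' t) p), (Elin _ (fun t => p t * p' t) p'), E1, Ef, Eg.
    1: ring.
    all: cont. }
  assert (HMM : 0 <= M * M') by now apply Rmult_le_pos.
  (* The s^3 term is subtracted before absolute values are taken, to keep the sign cancellation in
     the third moment. The coefficient 9 of s^4 is 5/2 + 5/2 + 3 + 1, the last from a b s^4. *)
  assert (Main : Rabs (E (fun t => p t * p' t) - F * G * V
                       - (F * b + a * G) * E (fun t => (t - x) ^ 3))
    <= K ^ 2 * ((N * w' + N' * w + w * w' + q ^ 2 * (M * M')) * V
                + 9 * (M * M') * E (fun t => (t - x) ^ 4))).
  { replace (E (fun t => p t * p' t) - F * G * V - (F * b + a * G) * E (fun t => (t - x) ^ 3))
      with (E (fun t => p t * p' t + (- (F * G)) * (t - x) ^ 2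
                        + (- (F * b + a * G)) * (t - x) ^ 3)).
    2:{ rewrite (Elin _ (fun t => p t * p' t + (- (F * G)) * (t - x) ^ 2)
                   (fun t => (t - x) ^ 3)),
          (Elin _ (fun t => p t * p' t) (fun t => (t - x) ^ 2)), Es2; [ring | cont ..]. }
    replace (K ^ 2 * ((N * w' + N' * w + w * w' + q ^ 2 * (M * M')) * V
                + 9 * (M * M') * E (fun t => (t - x) ^ 4)))
      with (E (fun t => zero t + K ^ 2 * (N * w' + N' * w + w * w' + q ^ 2 * (M * M')) * (t - x) ^ 2
                 + K ^ 2 * (9 * (M * M')) * (t - x) ^ 4)).
    2:{ rewrite (Elin _ (fun t => zero t + K ^ 2 * (N * w' + N' * w + w * w' + q ^ 2 * (M * M'))
                                     * (t - x) ^ 2) (fun t => (t - x) ^ 4)),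
          (Elin _ zero (fun t => (t - x) ^ 2)), Es2; [|cont ..].
        rewrite E0; ring. }
    apply Ele.
    - cont.
    - cont.
    - intros t Ht. specialize (Hs1 t Ht). specialize (Tf t Ht). specialize (Tg t Ht).
      set (s := t - x) in *.
      set (r := f t - f x - F * s - a * s ^ 2) in *.
      set (r' := g t - g x - G * s - b * s ^ 2) in *.
      assert (B1 := cross_term_bound K N w' M M' q F a s r' HK Hq Hw' HM HM' Hs1 HFN HFM Ha Hwq' Tg).
      assert (B2 := cross_term_bound K N' w M' M q G b s r HK Hq Hw HM' HM Hs1 HGN HGM Hb Hwq Tf).
      assert (B3 := remainder_product_bound K w w' M M' q s r r' HK Hq Hw Hw' HM HM' Hs1
                      Hwq Hwq' Tf Tg).
      assert (B4 : Rabs (a * b * s ^ 4) <= K ^ 2 * (M * M') * s ^ 4).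
      { assert (0 <= s ^ 4) by (replace (s ^ 4) with ((s ^ 2) ^ 2) by ring; apply pow2_ge_0).
        rewrite Rabs_mult, (Rabs_pos_eq (s ^ 4)) by assumption.
        apply Rmult_le_compat_r; [assumption|].
        apply Rle_trans with (1 := Rmult_Rabs_le _ _ _ _ Ha Hb). right; ring. }
      replace (p t * p' t + - (F * G) * s ^ 2 + - (F * b + a * G) * s ^ 3) with
        ((F * s + a * s ^ 2) * r' + (G * s + b * s ^ 2) * r + r * r' + a * b * s ^ 4).
      2:{ unfold r, r', p, p'. ring. }
      apply Rle_trans with (1 := Rabs_plus_le _ _ _ _
        (Rabs_plus_le _ _ _ _ (Rabs_plus_le _ _ _ _ B1 B2) B3) B4).
      right; unfold zero; field. }
  (* Since E s = 0, the linear coefficient [A] disappears without needing any bound. The quadratic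
     term and the cubic remainder, with |s|^3 <= s^2, each contribute K m V. *)
  assert (First : forall (u : R -> R) (A c m v : R),
    (forall t : R, continuous u t) -> 0 <= v -> 0 <= m -> Rabs c <= K * m ->
    (forall t, 0 <= t <= 1 -> Rabs (u t - A * (t - x) - c * (t - x) ^ 2)
       <= K * (v * Rabs (t - x) + m * Rabs (t - x) ^ 3)) ->
    Rabs (E u) <= K * v * E (fun t => Rabs (t - x)) + 2 * K * m * V).
  { intros u A c m v Cu Hv Hm Hc Hu.
    replace (E u) with (E (fun t => u t + (- A) * (t - x))).
    2:{ rewrite (Elin _ u (fun t => t - x)), Es1 by cont. ring. }
    replace (K * v * E (fun t => Rabs (t - x)) + 2 * K * m * V)
      with (E (fun t => zero t + K * v * Rabs (t - x) + 2 * K * m * (t - x) ^ 2)).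
    2:{ rewrite (Elin _ (fun t => zero t + K * v * Rabs (t - x)) (fun t => (t - x) ^ 2)),
          (Elin _ zero (fun t => Rabs (t - x))), Es2; [|cont ..].
        rewrite E0; ring. }
    apply Ele.
    - cont.
    - cont.
    - intros t Ht. specialize (Hs1 t Ht). specialize (Hu t Ht).
      set (s := t - x) in *. assert (Hs0 := Rabs_pos s).
      assert (B1 : Rabs (c * s ^ 2) <= K * m * s ^ 2).
      { rewrite Rabs_mult, (Rabs_pos_eq (s ^ 2)) by apply pow2_ge_0.
        apply Rmult_le_compat_r; [apply pow2_ge_0 | assumption]. }
      assert (B2 : K * m * Rabs s ^ 3 <= K * m * s ^ 2).
      { apply Rmult_le_compat_l; [nra|]. rewrite <- (pow2_abs s). simpl; nra. }
      replace (u t + - A * s) with (u t - A * s - c * s ^ 2 + c * s ^ 2) by ring.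
      apply Rle_trans with (1 := Rabs_plus_le _ _ _ _ Hu B1). unfold zero; lra. }
  assert (Hp := First p F a M w Cp Hw HM Ha ltac:(intros t Ht; unfold p;
    replace (f t + - f x * 1 - F * (t - x) - a * (t - x) ^ 2)
      with (f t - f x - F * (t - x) - a * (t - x) ^ 2) by ring; auto)).
  assert (Hp' := First p' G b M' w' Cp' Hw' HM' Hb ltac:(intros t Ht; unfold p';
    replace (g t + - g x * 1 - G * (t - x) - b * (t - x) ^ 2)
      with (g t - g x - G * (t - x) - b * (t - x) ^ 2) by ring; auto)).
  set (e := E (fun t => Rabs (t - x))) in *.
  assert (He0 : 0 <= e) by (apply Epos; [cont | intros; apply Rabs_pos]).
  (* Cauchy-Schwarz, from positivity at [(|t - x| - e)^2] *)
  assert (HeV : e ^ 2 <= V).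
  { assert (A : 0 <= E (fun t => (t - x) ^ 2 + (-2 * e) * Rabs (t - x) + e ^ 2 * 1)).
    { apply Epos.
      - cont.
      - intros t _. rewrite <- (pow2_abs (t - x)).
        assert (B := pow2_ge_0 (Rabs (t - x) - e)). lra. }
    rewrite (Elin _ (fun t => (t - x) ^ 2 + (-2 * e) * Rabs (t - x)) (fun _ => 1)),
      (Elin _ (fun t => (t - x) ^ 2) (fun t => Rabs (t - x))), E1, Es2 in A; [|cont ..].
    fold e in A. lra. }
  assert (Heq : e <= q).
  { apply Rsqr_incr_0_var; [|lra]. unfold Rsqr. nra. }
  (* The remaining ingredients are e <= q, V <= q^2 and w <= q M: the mixed terms and the V^2 term
     each give 4 q^2 M M' V. *)
  assert (Prod : Rabs (E p * E p') <= K ^ 2 * V * (w * w' + 8 * (q ^ 2 * (M * M')))).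
  { apply Rle_trans with (1 := Rmult_Rabs_le _ _ _ _ Hp Hp').
    replace ((K * w * e + 2 * K * M * V) * (K * w' * e + 2 * K * M' * V))
      with (K ^ 2 * (w * w' * e ^ 2 + 2 * (w * M' + w' * M) * e * V + 4 * (M * M') * V ^ 2))
      by ring.
    rewrite (Rmult_assoc (K ^ 2) V). apply Rmult_le_compat_l; [apply pow2_ge_0|].
    assert (P1 : w * w' * e ^ 2 <= w * w' * V).
    { apply Rmult_le_compat_l; [now apply Rmult_le_pos | assumption]. }
    assert (P2 : w * M' <= q * (M * M')).
    { rewrite <- Rmult_assoc. now apply Rmult_le_compat_r. }
    assert (P3 : w' * M <= q * (M * M')).
    { replace (q * (M * M')) with (q * M' * M) by ring. now apply Rmult_le_compat_r. }
    assert (P4 : 2 * (w * M' + w' * M) * e <= 4 * (q * (M * M')) * q).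
    { apply Rmult_le_compat; try assumption; [|lra].
      assert (0 <= w * M') by now apply Rmult_le_pos.
      assert (0 <= w' * M) by now apply Rmult_le_pos. lra. }
    assert (P5 : 2 * (w * M' + w' * M) * e * V <= 4 * (q * (M * M')) * q * V).
    { now apply Rmult_le_compat_r. }
    assert (P6 : 4 * (M * M') * V * V <= 4 * (M * M') * V * q ^ 2).
    { apply Rmult_le_compat_l; [|lra]. apply Rmult_le_pos; [lra | assumption]. }
    lra. }
  assert (Third : Rabs ((F * b + a * G) * E (fun t => (t - x) ^ 3))
                  <= 12 * (K ^ 2 * V * (q ^ 2 * (M * M')))).
  { assert (A1 := Rmult_Rabs_le _ _ _ _ HFM Hb). assert (A2 := Rmult_Rabs_le _ _ _ _ Ha HGM).
    assert (A3 : Rabs (F * b + a * G) <= 2 * K ^ 2 * (M * M')).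
    { apply Rle_trans with (1 := Rabs_triang _ _). lra. }
    apply Rle_trans with (1 := Rmult_Rabs_le _ _ _ _ A3 Es3).
    right. unfold V. rewrite Hd. ring. }
  assert (Fourth : K ^ 2 * (9 * (M * M') * E (fun t => (t - x) ^ 4))
                   <= 63 * (K ^ 2 * V * (q ^ 2 * (M * M')))).
  { apply Rle_trans with (K ^ 2 * (9 * (M * M') * (7 * (x * (1 - x)) * d ^ 2))).
    - apply Rmult_le_compat_l; [apply pow2_ge_0|]. apply Rmult_le_compat_l; [lra | assumption].
    - right. unfold V. rewrite Hd. ring. }
  rewrite Efg.
  set (m3 := E (fun t => (t - x) ^ 3)) in *.
  replace (E (fun t => p t * p' t) - E p * E p' - F * G * V) with
    (E (fun t => p t * p' t) - F * G * V - (F * b + a * G) * m3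
     + (F * b + a * G) * m3 + - (E p * E p')) by ring.
  rewrite <- Rabs_Ropp in Prod.
  apply Rle_trans with (1 := Rabs_plus_le _ _ _ _ (Rabs_plus_le _ _ _ _ Main Third) Prod).
  lra.
Qed.

(** * Central moments of the operators *)

Lemma U_linear (rho : R) (n : nat) (x c : R) (f g : R -> R) :
  0 < rho -> (1 <= n)%nat ->
  (forall t : R, continuous f t) -> (forall t : R, continuous g t) ->
  U rho n (fun t => f t + c * g t) x = U rho n f x + c * U rho n g x.
Proof.
  intros Hr Hn Hf Hg. rewrite !U_binexp by assumption.
  rewrite <- binexp_linear. apply binexp_ext; intros k Hk. now apply node_linear.
Qed.

Lemma U_nonneg (rho : R) (n : nat) (x : R) (f : R -> R) :
  0 < rho -> (1 <= n)%nat -> 0 <= x <= 1 -> (forall t : R, continuous f t) ->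
  (forall t, 0 <= t <= 1 -> 0 <= f t) -> 0 <= U rho n f x.
Proof.
  intros Hr Hn Hx Hf H. rewrite U_binexp by assumption.
  apply binexp_nonneg; [assumption|]. intros k Hk. now apply node_nonneg.
Qed.

(** Functions given on [0,1] only may be replaced by extensions continuous on the whole line, as the
    lemmas on positive functionals require. *)
Lemma U_ext (rho : R) (n : nat) (x : R) (f g : R -> R) :
  0 < rho -> (1 <= n)%nat -> (forall t : R, continuous f t) ->
  (forall t, 0 <= t <= 1 -> f t = g t) -> U rho n f x = U rho n g x.
Proof.
  intros Hr Hn Hf H. rewrite !U_binexp by assumption.
  apply binexp_ext; intros k Hk. now apply node_ext.
Qed.

Lemma binexp_quartic (n : nat) (x a1 a2 a3 a4 : R) :
  binexp n x (fun k => a1 * INR k + a2 * INR k ^ 2 + a3 * INR k ^ 3 + a4 * INR k ^ 4)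
  = a1 * binexp n x (fun k => INR k) + a2 * binexp n x (fun k => INR k ^ 2)
    + a3 * binexp n x (fun k => INR k ^ 3) + a4 * binexp n x (fun k => INR k ^ 4).
Proof.
  (* The null expression [1 + (-1) * 1] supplies a head term, so that all four coefficients match
     the pattern of [binexp_linear]. *)
  rewrite (binexp_ext n x _ (fun k => 1 + (-1) * 1 + a1 * INR k + a2 * INR k ^ 2
             + a3 * INR k ^ 3 + a4 * INR k ^ 4)) by (intros; ring).
  rewrite !binexp_linear.
  change (binexp n x (fun k => INR k)) with (binexp n x INR). ring.
Qed.

(** The j-th moment at a node is the rising factorial of k rho over that of n rho. Its expansion in
    powers of k gives the coefficients 1, 3, 2 and 1, 6, 11, 6, and the binomial moments finish the
    computation. *)
Lemma U_moments (rho : R) (n : nat) (x : R) :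
  0 < rho -> (1 <= n)%nat ->
  let N := INR n in let P := N * rho in
  let m2 := N * (N - 1) * x ^ 2 + N * x in
  let m3 := N * (N - 1) * (N - 2) * x ^ 3 + 3 * N * (N - 1) * x ^ 2 + N * x in
  let m4 := N * (N - 1) * (N - 2) * (N - 3) * x ^ 4 + 6 * N * (N - 1) * (N - 2) * x ^ 3
      + 7 * N * (N - 1) * x ^ 2 + N * x in
  U rho n (fun _ => 1) x = 1 /\
  U rho n (fun t => t ^ 1) x = x /\
  U rho n (fun t => t ^ 2) x = (rho ^ 2 * m2 + rho * (N * x)) / (P * (P + 1)) /\
  U rho n (fun t => t ^ 3) x
    = (rho ^ 3 * m3 + 3 * rho ^ 2 * m2 + 2 * rho * (N * x)) / (P * (P + 1) * (P + 2)) /\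
  U rho n (fun t => t ^ 4) x
    = (rho ^ 4 * m4 + 6 * rho ^ 3 * m3 + 11 * rho ^ 2 * m2 + 6 * rho * (N * x))
      / (P * (P + 1) * (P + 2) * (P + 3)).
Proof.
  intros Hr Hn N P m2 m3 m4.
  assert (HN : 0 < N) by (apply lt_0_INR; lia).
  assert (HP : 0 < P) by now apply Rmult_lt_0_compat.
  destruct (binexp_moments n x) as [B0 [B1 [B2 [B3 B4]]]].
  fold N m2 m3 m4 in B0, B1, B2, B3, B4.
  assert (V1 : forall k, (k <= n)%nat -> node rho n k (fun t => t ^ 1) = INR k * rho / P).
  { intros k Hk. assert (E := node_pow_succ rho n k 0 Hr Hn Hk).
    change (node rho n k (fun t => t ^ 0)) with (node rho n k (fun _ => 1)) in E.
    rewrite node_one in E by assumption. simpl INR in E. fold N P in E.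
    apply Rmult_eq_reg_l with P; [|lra]. rewrite Rplus_0_r in E. rewrite E. field; lra. }
  assert (V2 : forall k, (k <= n)%nat -> node rho n k (fun t => t ^ 2)
             = INR k * rho * (INR k * rho + 1) / (P * (P + 1))).
  { intros k Hk. assert (E := node_pow_succ rho n k 1 Hr Hn Hk).
    rewrite V1 in E by assumption. simpl INR in E. fold N P in E.
    apply Rmult_eq_reg_l with (P + 1); [|lra]. rewrite E. field; lra. }
  assert (V3 : forall k, (k <= n)%nat -> node rho n k (fun t => t ^ 3)
             = INR k * rho * (INR k * rho + 1) * (INR k * rho + 2) / (P * (P + 1) * (P + 2))).
  { intros k Hk. assert (E := node_pow_succ rho n k 2 Hr Hn Hk).
    rewrite V2 in E by assumption. replace (INR 2) with 2 in E by (simpl; ring). fold N P in E.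
    apply Rmult_eq_reg_l with (P + 2); [|lra]. rewrite E. field; lra. }
  assert (V4 : forall k, (k <= n)%nat -> node rho n k (fun t => t ^ 4)
             = INR k * rho * (INR k * rho + 1) * (INR k * rho + 2) * (INR k * rho + 3)
               / (P * (P + 1) * (P + 2) * (P + 3))).
  { intros k Hk. assert (E := node_pow_succ rho n k 3 Hr Hn Hk).
    rewrite V3 in E by assumption. replace (INR 3) with 3 in E by (simpl; ring). fold N P in E.
    apply Rmult_eq_reg_l with (P + 3); [|lra]. rewrite E. field; lra. }
  rewrite !U_binexp by assumption. split; [|split; [|split; [|split]]].
  - transitivity (binexp n x (fun _ => 1)); [|exact B0].
    apply binexp_ext; intros; now apply node_one.
  - rewrite (binexp_ext n x _ (fun k => rho / P * INR k + 0 * INR k ^ 2 + 0 * INR k ^ 3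
               + 0 * INR k ^ 4)).
    + rewrite binexp_quartic, B1, B2, B3, B4. unfold P; field; lra.
    + intros k Hk. rewrite V1 by assumption. field; lra.
  - rewrite (binexp_ext n x _ (fun k => rho / (P * (P + 1)) * INR k
               + rho ^ 2 / (P * (P + 1)) * INR k ^ 2 + 0 * INR k ^ 3 + 0 * INR k ^ 4)).
    + rewrite binexp_quartic, B1, B2, B3, B4. field; lra.
    + intros k Hk. rewrite V2 by assumption. field; lra.
  - rewrite (binexp_ext n x _ (fun k => 2 * rho / (P * (P + 1) * (P + 2)) * INR k
               + 3 * rho ^ 2 / (P * (P + 1) * (P + 2)) * INR k ^ 2
               + rho ^ 3 / (P * (P + 1) * (P + 2)) * INR k ^ 3 + 0 * INR k ^ 4)).
    + rewrite binexp_quartic, B1, B2, B3, B4. field; lra.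
    + intros k Hk. rewrite V3 by assumption. field; lra.
  - rewrite (binexp_ext n x _ (fun k => 6 * rho / (P * (P + 1) * (P + 2) * (P + 3)) * INR k
               + 11 * rho ^ 2 / (P * (P + 1) * (P + 2) * (P + 3)) * INR k ^ 2
               + 6 * rho ^ 3 / (P * (P + 1) * (P + 2) * (P + 3)) * INR k ^ 3
               + rho ^ 4 / (P * (P + 1) * (P + 2) * (P + 3)) * INR k ^ 4)).
    + rewrite binexp_quartic, B1, B2, B3, B4. field; lra.
    + intros k Hk. rewrite V4 by assumption. field; lra.
Qed.

Lemma continuous_everywhere_monomial (k : nat) (t : R) : continuous (fun t : R => t ^ k) t.
Proof. apply (ex_derive_continuous (fun t => t ^ k)); auto_derive; exact I. Qed.

Lemma U_central_moments (rho : R) (n : nat) (x : R) :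
  0 < rho -> (1 <= n)%nat ->
  let N := INR n in let X := x * (1 - x) in let P := N * rho in
  U rho n (fun t => t - x) x = 0 /\
  U rho n (fun t => (t - x) ^ 2) x = X * ((rho + 1) / (P + 1)) /\
  U rho n (fun t => (t - x) ^ 3) x
    = X * (1 - 2 * x) * ((rho + 1) * (rho + 2) / ((P + 1) * (P + 2))) /\
  U rho n (fun t => (t - x) ^ 4) x
    = X * ((rho + 1) * (3 * (rho + 1) * P * X - 6 * (rho ^ 2 + 3 * rho + 3) * X
                        + (rho + 2) * (rho + 3)) / ((P + 1) * (P + 2) * (P + 3))).
Proof.
  intros Hr Hn N X P.
  assert (HN : 0 < N) by (apply lt_0_INR; lia).
  assert (HP : 0 < P) by now apply Rmult_lt_0_compat.
  destruct (U_moments rho n x Hr Hn) as [M0 [M1 [M2 [M3 M4]]]].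
  fold N P in M0, M1, M2, M3, M4.
  assert (C1 : forall t : R, continuous (fun _ => 1) t) by cont.
  assert (Cm := continuous_everywhere_monomial).
  assert (Q2 : forall t : R, continuous (fun t : R => t ^ 2 + (- 2 * x) * t ^ 1) t).
  { apply (continuous_everywhere_lin _ (fun t => t ^ 2)); auto. }
  assert (Q3 : forall t : R, continuous (fun t : R => t ^ 3 + (- 3 * x) * t ^ 2 + 3 * x ^ 2 * t ^ 1) t).
  { apply (continuous_everywhere_lin _ (fun t => t ^ 3 + (- 3 * x) * t ^ 2)); auto.
    apply (continuous_everywhere_lin _ (fun t => t ^ 3)); auto. }
  assert (Q4 : forall t : R, continuous (fun t : R => t ^ 4 + (- 4 * x) * t ^ 3 + 6 * x ^ 2 * t ^ 2
                + (- 4 * x ^ 3) * t ^ 1) t).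
  { apply (continuous_everywhere_lin _ (fun t => t ^ 4 + (- 4 * x) * t ^ 3 + 6 * x ^ 2 * t ^ 2)); auto.
    apply (continuous_everywhere_lin _ (fun t => t ^ 4 + (- 4 * x) * t ^ 3)); auto.
    apply (continuous_everywhere_lin _ (fun t => t ^ 4)); auto. }
  split; [|split; [|split]].
  - replace (fun t => t - x) with (fun t => t ^ 1 + (- x) * 1)
      by (apply functional_extensionality; intros; ring).
    rewrite (U_linear _ _ _ _ (fun t => t ^ 1) (fun _ => 1)), M0, M1 by auto. ring.
  - replace (fun t => (t - x) ^ 2) with (fun t => t ^ 2 + (- 2 * x) * t ^ 1 + x ^ 2 * 1)
      by (apply functional_extensionality; intros; ring).
    rewrite (U_linear _ _ _ _ (fun t => t ^ 2 + (- 2 * x) * t ^ 1) (fun _ => 1)),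
      (U_linear _ _ _ _ (fun t => t ^ 2) (fun t => t ^ 1)), M0, M1, M2 by auto.
    unfold X, P; field. fold P; lra.
  - replace (fun t => (t - x) ^ 3) with
      (fun t => t ^ 3 + (- 3 * x) * t ^ 2 + 3 * x ^ 2 * t ^ 1 + (- x ^ 3) * 1)
      by (apply functional_extensionality; intros; ring).
    rewrite (U_linear _ _ _ _ (fun t => t ^ 3 + (- 3 * x) * t ^ 2 + 3 * x ^ 2 * t ^ 1) (fun _ => 1)),
      (U_linear _ _ _ _ (fun t => t ^ 3 + (- 3 * x) * t ^ 2) (fun t => t ^ 1)),
      (U_linear _ _ _ _ (fun t => t ^ 3) (fun t => t ^ 2)), M0, M1, M2, M3; auto.
    + unfold X, P; field. fold P; lra.
    + apply (continuous_everywhere_lin _ (fun t => t ^ 3)); auto.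
  - replace (fun t => (t - x) ^ 4) with
      (fun t => t ^ 4 + (- 4 * x) * t ^ 3 + 6 * x ^ 2 * t ^ 2 + (- 4 * x ^ 3) * t ^ 1 + x ^ 4 * 1)
      by (apply functional_extensionality; intros; ring).
    rewrite (U_linear _ _ _ _ (fun t => t ^ 4 + (- 4 * x) * t ^ 3 + 6 * x ^ 2 * t ^ 2
                + (- 4 * x ^ 3) * t ^ 1) (fun _ => 1)),
      (U_linear _ _ _ _ (fun t => t ^ 4 + (- 4 * x) * t ^ 3 + 6 * x ^ 2 * t ^ 2) (fun t => t ^ 1)),
      (U_linear _ _ _ _ (fun t => t ^ 4 + (- 4 * x) * t ^ 3) (fun t => t ^ 2)),
      (U_linear _ _ _ _ (fun t => t ^ 4) (fun t => t ^ 3)), M0, M1, M2, M3, M4; auto.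
    + unfold X, P; field. fold P; lra.
    + apply (continuous_everywhere_lin _ (fun t => t ^ 4)); auto.
    + apply (continuous_everywhere_lin _ (fun t => t ^ 4 + (- 4 * x) * t ^ 3)); auto.
      apply (continuous_everywhere_lin _ (fun t => t ^ 4)); auto.
Qed.

(** Everything rests on rho <= n rho, that is n >= 1, and on rho + 2 <= 2(rho + 1): these let the
    numerators absorb the shifts 2 and 3 uniformly in [rho]. In the fourth moment the negative term
    is dropped and x(1-x) <= 1/4 is used. *)
Lemma U_central_moment_bounds (rho : R) (n : nat) (x : R) :
  0 < rho -> (1 <= n)%nat -> 0 <= x <= 1 ->
  let d := (rho + 1) / (INR n * rho + 1) in
  Rabs (U rho n (fun t => (t - x) ^ 3) x) <= 6 * (x * (1 - x)) * d ^ 2 /\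
  U rho n (fun t => (t - x) ^ 4) x <= 7 * (x * (1 - x)) * d ^ 2.
Proof.
  intros Hr Hn Hx d.
  destruct (U_central_moments rho n x Hr Hn) as [_ [_ [M3 M4]]].
  assert (HN : 1 <= INR n) by (apply (le_INR 1); assumption).
  set (X := x * (1 - x)) in *. set (P := INR n * rho) in *.
  assert (HP : rho <= P) by (unfold P; nra).
  assert (HX : 0 <= X <= 1 / 4) by (assert (S := pow2_ge_0 (x - 1 / 2)); unfold X; nra).
  rewrite M3, M4. unfold d. split.
  - assert (HA : Rabs (1 - 2 * x) <= 1) by (apply Rabs_le_between; lra).
    assert (B : 0 <= (rho + 1) * (rho + 2) / ((P + 1) * (P + 2))
                <= 6 * ((rho + 1) / (P + 1)) ^ 2).
    { split.
      - apply Rmult_le_pos; [nra | left; apply Rinv_0_lt_compat; nra].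
      - replace ((rho + 1) * (rho + 2) / ((P + 1) * (P + 2)))
          with ((rho + 1) / (P + 1) * ((rho + 2) / (P + 2))) by (field; lra).
        replace (6 * ((rho + 1) / (P + 1)) ^ 2)
          with ((rho + 1) / (P + 1) * (6 * (rho + 1) / (P + 1))) by (field; lra).
        apply Rmult_le_compat_l.
        + apply Rmult_le_pos; [lra | left; apply Rinv_0_lt_compat; lra].
        + apply Rle_div_l; [lra|].
          replace (6 * (rho + 1) / (P + 1) * (P + 2))
            with (6 * (rho + 1) * (1 + / (P + 1))) by (field; lra).
          assert (0 < / (P + 1)) by (apply Rinv_0_lt_compat; lra). nra. }
    rewrite !Rabs_mult, (Rabs_pos_eq X), (Rabs_pos_eq (_ / _)) by lra.
    replace (6 * X * ((rho + 1) / (P + 1)) ^ 2)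
      with (X * 1 * (6 * ((rho + 1) / (P + 1)) ^ 2)) by ring.
    apply Rmult_le_compat; try lra.
    + apply Rmult_le_pos; [lra | apply Rabs_pos].
    + apply Rmult_le_compat_l; lra.
  - replace (7 * X * ((rho + 1) / (P + 1)) ^ 2)
      with (X * (7 * ((rho + 1) / (P + 1)) ^ 2)) by ring.
    apply Rmult_le_compat_l; [lra|].
    apply Rle_trans with ((rho + 1) * (7 * (rho + 1) * (P + 3)) / ((P + 1) * (P + 2) * (P + 3))).
    + apply Rmult_le_compat_r; [left; apply Rinv_0_lt_compat; repeat apply Rmult_lt_0_compat; lra|].
      apply Rmult_le_compat_l; [lra|].
      assert (A1 : (rho + 1) * P * X <= (rho + 1) * P * (1 / 4)).
      { apply Rmult_le_compat_l; [|lra]. apply Rmult_le_pos; lra. }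
      assert (A2 : 0 <= (rho ^ 2 + 3 * rho + 3) * X) by (apply Rmult_le_pos; nra).
      nra.
    + replace ((rho + 1) * (7 * (rho + 1) * (P + 3)) / ((P + 1) * (P + 2) * (P + 3)))
        with (7 * (rho + 1) ^ 2 / (P + 1) * / (P + 2)) by (field; lra).
      replace (7 * ((rho + 1) / (P + 1)) ^ 2)
        with (7 * (rho + 1) ^ 2 / (P + 1) * / (P + 1)) by (field; lra).
      apply Rmult_le_compat_l.
      * apply Rmult_le_pos; [nra | left; apply Rinv_0_lt_compat; lra].
      * apply Rinv_le_contravar; lra.
Qed.

(** * Functions of class C^1 on [0,1] *)

(** Retraction of the line onto [0,1]. The values of [f] and [df] outside [0,1] are arbitrary, so
    composing with it is what yields functions continuous everywhere. *)
Definition clamp (t : R) : R := Rmax 0 (Rmin 1 t).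

Lemma clamp_range (t : R) : 0 <= clamp t <= 1.
Proof. unfold clamp, Rmax, Rmin; repeat destruct Rle_dec; lra. Qed.

Lemma clamp_id (t : R) : 0 <= t <= 1 -> clamp t = t.
Proof. intros Ht; unfold clamp. rewrite Rmin_right, Rmax_right by lra. reflexivity. Qed.

Lemma clamp_lipschitz (s t : R) : Rabs (clamp s - clamp t) <= Rabs (s - t).
Proof.
  unfold clamp, Rmax, Rmin, Rabs; repeat destruct Rle_dec; repeat destruct Rcase_abs; lra.
Qed.

Lemma continuous_clamp (h : R -> R) :
  (forall x, 0 <= x <= 1 ->
     filterlim h (within (fun y => 0 <= y <= 1) (locally x)) (locally (h x))) ->
  forall t : R, continuous (fun t => h (clamp t)) t.
Proof.
  intros H t P HP. destruct (H (clamp t) (clamp_range t) P HP) as [e He].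
  exists e; intros y Hy. apply He; [|apply clamp_range].
  apply Rle_lt_trans with (2 := Hy). apply clamp_lipschitz.
Qed.

(** Near [x] the difference quotients are bounded by |df x| + 1, one-sided at the ends. *)
Lemma C1_01_continuous_within (f df : R -> R) :
  C1_01 f df -> forall x : R, 0 <= x <= 1 ->
  filterlim f (within (fun y => 0 <= y <= 1) (locally x)) (locally (f x)).
Proof.
  intros [Hf _] x Hx. apply filterlim_locally; intros eps.
  destruct (proj1 (filterlim_locally _ _) (Hf x Hx) (mkposreal 1 Rlt_0_1)) as [e He].
  set (L := Rabs (df x) + 1). assert (HL : 0 < L) by (assert (A := Rabs_pos (df x)); unfold L; lra).
  assert (Hd : 0 < Rmin e (eps / L)).
  { apply Rmin_pos; [apply cond_pos | apply Rdiv_lt_0_compat; [apply cond_pos | assumption]]. }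
  exists (mkposreal _ Hd); intros y Hy Hy01.
  change (Rabs (y - x) < Rmin e (eps / L)) in Hy. change (Rabs (f y - f x) < eps).
  destruct (Req_dec y x) as [->|Hne].
  { rewrite Rminus_diag, Rabs_R0; apply cond_pos. }
  assert (A : Rabs ((f y - f x) / (y - x) - df x) < 1).
  { apply He; [|split; assumption]. apply Rlt_le_trans with (1 := Hy), Rmin_l. }
  assert (B : Rabs ((f y - f x) / (y - x)) <= L).
  { replace ((f y - f x) / (y - x)) with (((f y - f x) / (y - x) - df x) + df x) by ring.
    apply Rle_trans with (1 := Rabs_triang _ _). unfold L; lra. }
  replace (f y - f x) with ((f y - f x) / (y - x) * (y - x)) by (field; lra).
  rewrite Rabs_mult.
  apply Rle_lt_trans with (L * Rabs (y - x)).
  - apply Rmult_le_compat_r; [apply Rabs_pos | assumption].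
  - replace (pos eps) with (L * (eps / L)) by (field; lra).
    apply Rmult_lt_compat_l; [assumption|].
    apply Rlt_le_trans with (1 := Hy), Rmin_r.
Qed.

Lemma C1_01_is_derive (f df : R -> R) :
  C1_01 f df -> forall x : R, 0 < x < 1 -> is_derive f x (df x).
Proof.
  intros [Hf _] x Hx. apply is_derive_Reals. intros eps Heps.
  assert (Hx01 : 0 <= x <= 1) by lra.
  destruct (proj1 (filterlim_locally _ _) (Hf x Hx01) (mkposreal eps Heps)) as [e He].
  assert (Hd : 0 < Rmin e (Rmin x (1 - x))).
  { repeat apply Rmin_pos; try lra. apply cond_pos. }
  exists (mkposreal _ Hd); intros h Hh0 Hh; simpl in Hh.
  assert (M1 := Rmin_l e (Rmin x (1 - x))). assert (M2 := Rmin_r e (Rmin x (1 - x))).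
  assert (M3 := Rmin_l x (1 - x)). assert (M4 := Rmin_r x (1 - x)).
  assert (A := He (x + h)). simpl in A.
  unfold ball in A; simpl in A; unfold AbsRing_ball, abs, minus, plus, opp in A; simpl in A.
  replace (x + h + - x) with h in A by ring.
  replace (x + h - x) with h in A by ring.
  apply A; [lra|]. apply Rabs_lt_between in Hh. lra.
Qed.

(** Extend the derivative by constants beyond the ends and integrate it; the primitive agrees with
    [f] on [0,1], because their difference has derivative 0 inside and vanishes at 0. *)
Lemma C1_01_extension (f df : R -> R) :
  C1_01 f df -> exists f1 F1 : R -> R,
    (forall t : R, is_derive f1 t (F1 t)) /\ (forall t : R, continuous F1 t) /\
    (forall t, 0 <= t <= 1 -> f t = f1 t) /\ (forall t, 0 <= t <= 1 -> df t = F1 t).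
Proof.
  intros HC.
  set (F1 := fun t => df (clamp t)).
  assert (CF : forall t : R, continuous F1 t) by (apply continuous_clamp, HC).
  set (f1 := fun t => f 0 + RInt F1 0 t).
  assert (D : forall t : R, is_derive f1 t (F1 t)).
  { intros t. unfold f1. evar_last.
    - apply (is_derive_plus (fun _ => f 0) (fun t => RInt F1 0 t)).
      + apply (is_derive_const (f 0)).
      + now apply is_derive_primitive.
    - apply (plus_zero_l (F1 t)). }
  assert (Cf1 : forall t : R, continuous f1 t).
  { intros t; apply (ex_derive_continuous f1). eexists; apply D. }
  exists f1, F1. split; [exact D | split; [exact CF | split]].
  - intros t Ht.
    (* The mean value theorem asks for two-sided continuity at the ends, which f o clamp has and [f]
       may lack. *)
    set (g := fun s => f (clamp s) - f1 s).
    destruct (MVT_gen g 0 t (fun _ => 0)) as [c [_ Hc]].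
    + rewrite Rmin_left, Rmax_right by lra. intros s Hs.
      evar_last.
      * apply (is_derive_minus (fun s => f (clamp s)) f1 s (df s)); [|apply D].
        apply (is_derive_ext_loc f); [|apply (C1_01_is_derive f df HC); lra].
        assert (Hd : 0 < Rmin s (1 - s)) by (apply Rmin_pos; lra).
        exists (mkposreal _ Hd); intros u Hu.
        apply Rabs_lt_between in Hu; simpl in Hu; unfold minus, plus, opp in Hu; simpl in Hu.
        assert (M3 := Rmin_l s (1 - s)). assert (M4 := Rmin_r s (1 - s)).
        rewrite clamp_id by lra. reflexivity.
      * unfold F1. rewrite clamp_id by lra. apply (minus_eq_zero (df s)).
    + intros s _. apply continuity_pt_filterlim.
      apply (continuous_minus (fun s => f (clamp s)) f1); [|apply Cf1].
      apply continuous_clamp. now apply (C1_01_continuous_within f df).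
    + unfold g, f1 in Hc. rewrite RInt_point, !clamp_id in Hc by lra.
      unfold zero in Hc; simpl in Hc. unfold f1. lra.
  - intros t Ht. unfold F1. now rewrite clamp_id.
Qed.

(** [real] maps an infinite supremum to 0, so an upper bound [B] must be exhibited before the
    supremum dominates anything. *)
Lemma le_real_Lub_Rbar (E : R -> Prop) (y B : R) :
  E y -> (forall z, E z -> z <= B) -> y <= real (Lub_Rbar E).
Proof.
  intros Hy HB. destruct (Lub_Rbar_correct E) as [H1 H2].
  assert (A : Rbar_le (Lub_Rbar E) (Finite B)) by (apply H2; intros z Hz; now apply HB).
  assert (C := H1 y Hy).
  destruct (Lub_Rbar E) as [l | |]; [exact C | contradiction | contradiction].
Qed.

Lemma Rabs_le_supnorm (f : R -> R) (B : R) :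
  (forall x, 0 <= x <= 1 -> Rabs (f x) <= B) ->
  forall x, 0 <= x <= 1 -> Rabs (f x) <= supnorm f.
Proof.
  intros HB x Hx. apply le_real_Lub_Rbar with B.
  - now exists x.
  - intros z [y [Hy ->]]. now apply HB.
Qed.

Lemma Rabs_le_omega3 (h : R -> R) (B delta : R) :
  (forall x, 0 <= x <= 1 -> Rabs (h x) <= B) ->
  forall x t, 0 < t <= delta -> 0 <= x -> x + 3 * t <= 1 ->
  Rabs (h (x + 3 * t) - 3 * h (x + 2 * t) + 3 * h (x + t) - h x) <= omega3 h delta.
Proof.
  intros HB x t Ht Hx Hxt. apply le_real_Lub_Rbar with (8 * B).
  - now exists x, t.
  - intros z [y [s [Hs [Hy [Hys ->]]]]].
    assert (A0 := HB y ltac:(lra)). assert (A1 := HB (y + s) ltac:(lra)).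
    assert (A2 := HB (y + 2 * s) ltac:(lra)). assert (A3 := HB (y + 3 * s) ltac:(lra)).
    apply Rabs_le_between in A0, A1, A2, A3. apply Rabs_le_between. lra.
Qed.

(* At the scale [h = q^(1/3)] the quantity [q * M] is [q * supnorm f + omega3 df h]. *)
Lemma C1_01_taylor (f df : R -> R) (h q : R) :
  C1_01 f df -> 0 < h <= 1 -> q = h ^ 3 ->
  exists f1, (forall t : R, continuous f1 t) /\ (forall t, 0 <= t <= 1 -> f t = f1 t) /\
  0 <= omega3 df h /\
  forall x, 0 <= x <= 1 -> Rabs (df x) <= supnorm df /\
  exists M a, 0 <= M /\ omega3 df h <= q * M /\
    q * M <= 2 * Rmax (q * supnorm f) (omega3 df h) /\
    Rabs (df x) <= 100000000000 * M /\ Rabs a <= 100000000000 * M /\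
    forall t, 0 <= t <= 1 ->
      Rabs (f1 t - f1 x - df x * (t - x) - a * (t - x) ^ 2)
      <= 100000000000 * (omega3 df h * Rabs (t - x) + M * Rabs (t - x) ^ 3).
Proof.
  intros HC Hh Hq.
  destruct (C1_01_extension f df HC) as [f1 [F1 [D [CF [Ef EF]]]]].
  assert (Cf1 : forall t : R, continuous f1 t).
  { intros t; apply (ex_derive_continuous f1). eexists; apply D. }
  destruct (continuous_bounded f1 0 1 ltac:(lra) (fun t _ => Cf1 t)) as [B0 [_ HB0]].
  destruct (continuous_bounded F1 0 1 ltac:(lra) (fun t _ => CF t)) as [B1 [_ HB1]].
  assert (Sf : forall x, 0 <= x <= 1 -> Rabs (f x) <= supnorm f).
  { apply Rabs_le_supnorm with B0. intros x Hx; rewrite Ef by assumption; auto. }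
  assert (HBd : forall x, 0 <= x <= 1 -> Rabs (df x) <= B1).
  { intros x Hx; rewrite EF by assumption; auto. }
  assert (Sd := Rabs_le_supnorm df B1 HBd).
  assert (Om := Rabs_le_omega3 df B1 h HBd).
  assert (Hw : 0 <= omega3 df h).
  { apply Rle_trans with (2 := Om 0 (h / 3) ltac:(lra) ltac:(lra) ltac:(lra)), Rabs_pos. }
  assert (Hh3 : 0 < h ^ 3) by (apply pow_lt; lra).
  assert (HN0 : 0 <= supnorm f) by (apply Rle_trans with (2 := Sf 0 ltac:(lra)), Rabs_pos).
  exists f1. split; [exact Cf1 | split; [exact Ef | split; [exact Hw|]]].
  intros x Hx. split; [now apply Sd|].
  destruct (taylor_approx h (omega3 df h) (supnorm f) f1 F1 x Hh Hx D) as [HF [a [Ha HT]]].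
  - intros t Ht. rewrite <- Ef by assumption. now apply Sf.
  - intros t s Hs Ht Hts. rewrite <- !EF by lra. now apply Om.
  - set (M := supnorm f + omega3 df h * / h ^ 3) in *.
    assert (Hi : 0 <= omega3 df h * / h ^ 3).
    { apply Rmult_le_pos; [assumption | left; now apply Rinv_0_lt_compat]. }
    assert (HqM : q * M = q * supnorm f + omega3 df h).
    { rewrite Hq; unfold M; field; lra. }
    assert (Hqf : 0 <= q * supnorm f) by (rewrite Hq; apply Rmult_le_pos; lra).
    exists M, a. rewrite HqM, EF by assumption.
    assert (X1 := Rmax_l (q * supnorm f) (omega3 df h)).
    assert (X2 := Rmax_r (q * supnorm f) (omega3 df h)).
    repeat split; try assumption; try lra. unfold M; lra.
Qed.

(** * The covariance estimate for the operators *)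

Theorem theorem3p2 :
  exists Crho : R -> R,
    (forall rho, 0 < rho -> 0 < Crho rho) /\
    (* C_rho remains bounded as rho -> +oo *)
    (exists M rho0, forall rho, rho0 <= rho -> Crho rho <= M) /\
    (forall (rho : R) (f df g dg : R -> R) (n : nat) (x : R),
       0 < rho -> C1_01 f df -> C1_01 g dg -> (1 <= n)%nat -> 0 <= x <= 1 ->
       let d := (rho + 1) / (INR n * rho + 1) in
       let d6 := Rpower d (1 / 6) in
       let d2 := Rpower d (1 / 2) in
       INR n * Rabs (U rho n (fun t => f t * g t) x - U rho n f x * U rho n g x
                     - (rho + 1) / (rho * INR n) * x * (1 - x) * df x * dg x)
       <= Crho rho * ((rho + 1) / rho) * x * (1 - x) *
          (omega3 df d6 * omega3 dg d6
           + supnorm df * omega3 dg d6 + supnorm dg * omega3 df d6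
           + Rmax (d2 * supnorm f) (omega3 df d6)
             * Rmax (d2 * supnorm g) (omega3 dg d6))).
Proof.
  set (K := 100000000000).
  (* 340 = 4 * 85: the 84 of the covariance bound, plus 1 for correcting the variance, times 4
     because both q M and q M' are at most twice the corresponding maximum. *)
  exists (fun _ => 340 * K ^ 2).
  split; [intros; unfold K; lra|].
  split; [exists (340 * K ^ 2), 0; intros; lra|].
  intros rho f df g dg n x Hr Hf Hg Hn Hx d d6 d2.
  assert (HN : 1 <= INR n) by (apply (le_INR 1); assumption).
  assert (HP : 0 < INR n * rho + 1) by nra.
  assert (Hd : 0 < d <= 1).
  { unfold d; split; [apply Rdiv_lt_0_compat; lra|].
    apply Rle_div_l; [assumption | nra]. }
  assert (Hroot : forall c, 0 < c -> 0 < Rpower d c <= 1).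
  { intros c Hc; split; [apply exp_pos|].
    rewrite <- (Rpower_1 1) by lra. replace (Rpower 1 1) with (Rpower 1 c).
    - apply Rle_Rpower_l; lra.
    - unfold Rpower; rewrite ln_1, !Rmult_0_r; reflexivity. }
  assert (H6 : 0 < d6 <= 1) by (apply Hroot; lra).
  assert (H2 : 0 < d2 <= 1) by (apply Hroot; lra).
  assert (H26 : d2 = d6 ^ 3).
  { unfold d2, d6. rewrite <- Rpower_pow by apply exp_pos. rewrite Rpower_mult.
    f_equal. simpl; field. }
  assert (Hd2 : d = d2 ^ 2).
  { unfold d2. rewrite <- Rpower_pow by apply exp_pos. rewrite Rpower_mult.
    replace (1 / 2 * INR 2) with 1 by (simpl; field). rewrite Rpower_1; lra. }
  destruct (C1_01_taylor f df d6 d2 Hf H6 H26) as [f1 [Cf [Ef [Hw Tf]]]].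
  destruct (C1_01_taylor g dg d6 d2 Hg H6 H26) as [g1 [Cg [Eg [Hw' Tg]]]].
  destruct (Tf x Hx) as [HFN [M [a [HM [HwM [HMmax [HF [Ha HT]]]]]]]].
  destruct (Tg x Hx) as [HGN [M' [b [HM' [HwM' [HMmax' [HG [Hb HT']]]]]]]].
  fold K in HF, Ha, HT, HG, Hb, HT'.
  destruct (U_central_moments rho n x Hr Hn) as [E1 [E2 _]].
  destruct (U_central_moment_bounds rho n x Hr Hn Hx) as [E3 E4].
  destruct (U_moments rho n x Hr Hn) as [E0 _].
  fold d in E2, E3, E4.
  rewrite <- (U_ext rho n x f1 f Hr Hn Cf) by (intros; symmetry; auto).
  rewrite <- (U_ext rho n x g1 g Hr Hn Cg) by (intros; symmetry; auto).
  rewrite <- (U_ext rho n x (fun t => f1 t * g1 t) (fun t => f t * g t) Hr Hn).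
  2:{ now apply continuous_everywhere_mult. }
  2:{ intros t Ht; now rewrite Ef, Eg. }
  assert (Cov := covariance_bound (fun u => U rho n u x) x d d2 K f1 g1 (df x) (dg x) a b
    (supnorm df) (supnorm dg) (omega3 df d6) (omega3 dg d6) M M'
    (fun c u v => U_linear rho n x c u v Hr Hn) (fun u => U_nonneg rho n x u Hr Hn Hx)
    E0 Hx E1 E2 E3 E4 Hd2 ltac:(lra) ltac:(unfold K; lra) Cf Cg Hw Hw' HM HM' HwM HwM'
    HFN HF Ha HGN HG Hb HT HT').
  cbv beta in Cov.
  set (w := omega3 df d6) in *. set (w' := omega3 dg d6) in *.
  set (N := supnorm df) in *. set (N' := supnorm dg) in *.
  set (m := Rmax (d2 * supnorm f) w) in *. set (m' := Rmax (d2 * supnorm g) w') in *.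
  set (X := x * (1 - x)) in *.
  assert (HX : 0 <= X) by (unfold X; nra).
  assert (HN0 : 0 <= N) by (apply Rle_trans with (2 := HFN), Rabs_pos).
  assert (HN0' : 0 <= N') by (apply Rle_trans with (2 := HGN), Rabs_pos).
  assert (HMM : d2 ^ 2 * (M * M') <= 4 * (m * m')).
  { replace (d2 ^ 2 * (M * M')) with (d2 * M * (d2 * M')) by ring.
    replace (4 * (m * m')) with (2 * m * (2 * m')) by ring.
    apply Rmult_le_compat; try assumption; apply Rmult_le_pos; lra. }
  assert (HMM0 : 0 <= d2 ^ 2 * (M * M')).
  { apply Rmult_le_pos; [apply pow2_ge_0 | now apply Rmult_le_pos]. }
  set (c := (rho + 1) / rho).
  assert (Hc : 0 < c) by (apply Rdiv_lt_0_compat; lra).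
  assert (Hrc : / rho <= c).
  { unfold c, Rdiv. rewrite <- (Rmult_1_l (/ rho)) at 1.
    apply Rmult_le_compat_r; [left; now apply Rinv_0_lt_compat | lra]. }
  (* Multiplying by n is harmless since n rho < n rho + 1; this produces the factor (rho+1)/rho of
     the conclusion. *)
  assert (Hnd : INR n * d <= c).
  { unfold d, c. replace (INR n * ((rho + 1) / (INR n * rho + 1)))
      with (INR n * (rho + 1) / (INR n * rho + 1)) by (field; lra).
    apply Rle_div_l; [assumption|].
    replace ((rho + 1) / rho * (INR n * rho + 1))
      with (INR n * (rho + 1) + (rho + 1) / rho) by (field; lra). fold c; lra. }
  set (C := U rho n (fun t => f1 t * g1 t) x - U rho n f1 x * U rho n g1 x) in *.
  (* The exact variance [X d] falls short of the normalisation [(rho+1)/(rho n) X] by [X d/(rho n)]. *)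
  replace (C - (rho + 1) / (rho * INR n) * x * (1 - x) * df x * dg x)
    with (C - df x * dg x * (X * d) + - (df x * dg x * X * d * / (rho * INR n))).
  2:{ unfold X, d; field; lra. }
  (* For the variance correction both derivatives are bounded through [M] and [M']: a term ||f'||
     ||g'|| is absent from the right-hand side, while d M M' is absorbed by the product of the
     maxima. *)
  assert (HFG := Rmult_Rabs_le _ _ _ _ HF HG).
  assert (HV : 0 <= X * d * / (rho * INR n)).
  { apply Rmult_le_pos; [apply Rmult_le_pos; [assumption | lra]|].
    left; apply Rinv_0_lt_compat; nra. }
  assert (B2 : Rabs (- (df x * dg x * X * d * / (rho * INR n)))
               <= K * M * (K * M') * X * d * / (rho * INR n)).
  { rewrite Rabs_Ropp.
    replace (df x * dg x * X * d * / (rho * INR n))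
      with (df x * dg x * (X * d * / (rho * INR n))) by ring.
    rewrite Rabs_mult, (Rabs_pos_eq (X * d * / (rho * INR n))) by assumption.
    replace (K * M * (K * M') * X * d * / (rho * INR n))
      with (K * M * (K * M') * (X * d * / (rho * INR n))) by ring.
    now apply Rmult_le_compat_r. }
  apply Rle_trans with (INR n * (K ^ 2 * (X * d) * (N * w' + N' * w + 2 * (w * w')
      + 84 * (d2 ^ 2 * (M * M'))) + K * M * (K * M') * X * d * / (rho * INR n))).
  { apply Rmult_le_compat_l; [lra | now apply Rabs_plus_le]. }
  set (S := N * w' + N' * w + 2 * (w * w') + 84 * (d2 ^ 2 * (M * M'))).
  assert (HS : 0 <= S).
  { assert (0 <= N * w') by now apply Rmult_le_pos.
    assert (0 <= N' * w) by now apply Rmult_le_pos.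
    assert (0 <= w * w') by now apply Rmult_le_pos. unfold S; lra. }
  replace (INR n * (K ^ 2 * (X * d) * S + K * M * (K * M') * X * d * / (rho * INR n)))
    with (K ^ 2 * X * (INR n * d * S + / rho * (d2 ^ 2 * (M * M')))).
  2:{ rewrite <- Hd2. field; lra. }
  replace (340 * K ^ 2 * c * x * (1 - x) * (w * w' + N * w' + N' * w + m * m'))
    with (K ^ 2 * X * (c * (340 * (w * w' + N * w' + N' * w + m * m')))) by (unfold X; ring).
  apply Rmult_le_compat_l.
  { apply Rmult_le_pos; [apply pow2_ge_0 | assumption]. }
  apply Rle_trans with (c * S + c * (d2 ^ 2 * (M * M'))).
  { apply Rplus_le_compat; now apply Rmult_le_compat_r. }
  rewrite <- Rmult_plus_distr_l. apply Rmult_le_compat_l; [lra|].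
  assert (0 <= N * w') by now apply Rmult_le_pos.
  assert (0 <= N' * w) by now apply Rmult_le_pos.
  assert (0 <= w * w') by now apply Rmult_le_pos. unfold S; lra.
Qed.
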